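(* Let $M=\prod_{\mathcal U}M_i$ be an infinite ultraproduct of finite $\mathcal{L}$-structures in a 1-dimensional asymptotic class such that $T=\operatorname{Th}(M)$ is nowhere trivial, and let $(M,H)=\prod_{\mathcal U}(M_i,H_i)$ be a pseudofinite $H$-structure with $\delta_M(H)=0$. For any finite tuple $\bar a$ in $(M,H)$ and any countable subset $A\subseteq M$, we have $$\operatorname{ldim}(\bar a/A)=\delta_M(\bar a/A).$$
   Context: A class $\mathcal{C}$ of finite $\mathcal{L}$-structures is a 1-dimensional asymptotic class if for every $\mathcal{L}$-formula $\varphi(x,\bar y)$ ($x$ a single variable) there are $C>0$ and a finite set $E\subset\mathbb{R}^{>0}$ such that for every $N\in\mathcal{C}$ and $\bar a\in N^{|\bar y|}$, either $|\varphi(N,\bar a)|\le C$ or $\big||\varphi(N,\bar a)|-\mu|N|\big|\le C|N|^{1/2}$ for some $\mu\in E$; and for each $\mu\in E$ there is an $\mathcal{L}$-formula $\varphi_\mu(\bar y)$ without parameters defining in each $N\in\mathcal{C}$ the set of $\bar a$ for which the latter holds with $\mu$. The theory $T$ of an infinite ultraproduct of members of such a class has $SU$-rank 1, hence is geometric (eliminates $\exists^\infty$, and $\mathrm{acl}$ satisfies exchange). In models of $T$, $\dim(\bar a/B)$ is the length of a maximal subtuple of $\bar a$ algebraically independent over $B$, and $\bar a\perp_BC$ means $\dim(\bar a/B\cup C)=\dim(\bar a/B)$. $T$ is nowhere trivial if, in a $|T|^+$-saturated model, for $|A|\le|T|$ and $p(x)\in S_1(A)$ non-algebraic, for some (equivalently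 all) $a\models p$ there are finite $\bar b,\bar c$ with $a\perp_A\bar b$, $a\perp_A\bar c$, $a\in\mathrm{acl}(A,\bar b,\bar c)$. $\mathcal{L}_H=\mathcal{L}\cup\{H\}$, $H$ a new unary predicate; $(M,H)$ is an $H$-structure if $H\subseteq M$ is $\mathcal{L}$-algebraically independent and, for every $A\subseteq M$ of finite dimension and every non-algebraic $\mathcal{L}$-type $p(x)\in S_1(A)$, $p$ is realized in $H$ and in $M\setminus\mathrm{acl}(A\cup H)$. The large dimension is $\operatorname{ldim}(\bar a/A)=\dim(\bar a/A\cup H)$. For an $\mathcal{L}_H$-definable $X=\prod_{\mathcal U}X(M_i)$, $\delta_M(X)=\lim_{i,\mathcal U}\log|X(M_i)|/\log|M_i|$, and $\delta_M(\bar a/A)=\inf\{\delta_M(X):\bar a\in X,\ X\ \mathcal{L}_H\text{-definable over }A\}$. The existence of such pseudofinite $H$-structures with $\delta_M(H)=0$ is known. *)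

(* Defs.v *)
From HB Require Import structures.
From mathcomp Require Import all_boot all_order all_algebra.
From mathcomp Require Import generic_quotient.
From mathcomp Require Import all_classical all_reals all_analysis.

Set Implicit Arguments.
Unset Strict Implicit.
Unset Printing Implicit Defensive.

Import Order.TTheory GRing.Theory Num.Theory numFieldNormedType.Exports.

Local Open Scope quotient_scope.
Local Open Scope classical_set_scope.
Local Open Scope card_scope.
Local Open Scope ring_scope.

(* Tuples are functions on 'I_n.  In a formula with [1 + n] free variables,
   the distinguished variable x is the first one. *)

Definition fcat (T : Type) (k m : nat) (x : 'I_k -> T) (y : 'I_m -> T) :
    'I_(k + m) -> T :=
  fun i => match fintype.split i with inl j => x j | inr j => y j end.

Definition single (T : Type) (x : T) : 'I_1 -> T := fun=> x.

Record language := Language {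
  fsym : Type;
  far : fsym -> nat;
  rsym : Type;
  rar : rsym -> nat }.

Inductive term (L : language) (n : nat) : Type :=
| Var of 'I_n
| App (f : fsym L) of ('I_(far f) -> term L n).

(* Well-scoped de Bruijn syntax: the free variables of [formula L n] are
   indexed by 'I_n, and [All] binds variable 0. *)
Inductive formula (L : language) : nat -> Type :=
| Fal n : formula L n
| Equ n : term L n -> term L n -> formula L n
| Rel n (r : rsym L) : ('I_(rar r) -> term L n) -> formula L n
| Imp n : formula L n -> formula L n -> formula L n
| All n : formula L (1 + n) -> formula L n.

Definition Neg (L : language) n (phi : formula L n) := Imp phi (Fal L n).

(* Structures are nonempty, as usual in model theory. *)
Record structure (L : language) (M : Type) := Structure {
  fint : forall f : fsym L, ('I_(far f) -> M) -> M;
  rint : forall r : rsym L, ('I_(rar r) -> M) -> Prop;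
  str_inh : inhabited M }.

Arguments fint {L M} _ f _.
Arguments rint {L M} _ r _.

Fixpoint eval L M (s : structure L M) n (v : 'I_n -> M) (t : term L n) : M :=
  match t with
  | Var i => v i
  | App f u => fint s f (fun j => eval s v (u j))
  end.

Fixpoint sat L M (s : structure L M) n (phi : formula L n) :
    ('I_n -> M) -> Prop :=
  match phi in formula _ n return ('I_n -> M) -> Prop with
  | Fal _ => fun=> False
  | Equ _ t u => fun v => eval s v t = eval s v u
  | Rel _ r u => fun v => rint s r (fun j => eval s v (u j))
  | Imp _ p q => fun v => sat s p v -> sat s q v
  | All _ p => fun v => forall x, sat s p (fcat (single x) v)
  end.

Definition no_vars (T : Type) : 'I_0 -> T :=
  fun i => False_rect T (notF (ltn_ord i)).

Definition Th L M (s : structure L M) : set (formula L 0) :=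
  [set phi | sat s phi (@no_vars M)].

Record pformula (L : language) (M : Type) (k : nat) := PFormula {
  pf_arity : nat;
  pf_form : formula L (k + pf_arity);
  pf_par : 'I_pf_arity -> M }.

Arguments pf_arity {L M k} _.
Arguments pf_form {L M k} _.
Arguments pf_par {L M k} _ _.

Definition pneg L M k (f : pformula L M k) : pformula L M k :=
  PFormula (Neg (pf_form f)) (pf_par f).

Definition psat L M (s : structure L M) k (f : pformula L M k)
    (x : 'I_k -> M) : Prop :=
  sat s (pf_form f) (fcat x (pf_par f)).

Definition params_in L M k (A : set M) : set (pformula L M k) :=
  [set f | forall i, A (pf_par f i)].

Definition solutions L M (s : structure L M) (f : pformula L M 1) : set M :=
  [set x | psat s f (single x)].

Section Geometry.
Variables (L : language) (M : Type) (s : structure L M).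

Definition acl (B : set M) : set M :=
  [set x | exists f : pformula L M 1,
     [/\ params_in B f, finite_set (solutions s f) & solutions s f x]].

Definition indep_subtuple n (a : 'I_n -> M) (B : set M) (I : {set 'I_n}) :=
  forall i, i \in I -> ~ acl (B `|` [set a j | j in [set j | j \in I :\ i]]) (a i).

(* By exchange all maximal independent subtuples have the same length; the
   maximum makes [dim] a total function. *)
Definition dim n (a : 'I_n -> M) (B : set M) : nat :=
  \max_(I : {set 'I_n} | `[< indep_subtuple a B I >]) #|I|.

Definition indep_from n (a : 'I_n -> M) (B C : set M) :=
  dim a (B `|` C) = dim a B.

Definition finite_dim (A : set M) :=
  exists d : nat, forall k (a : 'I_k -> M), range a `<=` A -> (dim a set0 <= d)%N.

Definition alg_indep_set (H : set M) :=
  forall h, H h -> ~ acl (H `\ h) h.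

Definition realizes (x : M) (p : set (pformula L M 1)) :=
  forall f, p f -> solutions s f x.

Definition complete_type (A : set M) (p : set (pformula L M 1)) :=
  [/\ p `<=` params_in A,
      forall q, q `<=` p -> finite_set q -> exists x, realizes x q
    & forall f, params_in A f -> p f \/ p (pneg f)].

Definition nonalgebraic (p : set (pformula L M 1)) :=
  forall f, p f -> infinite_set (solutions s f).

(* kappa^+-saturation, where kappa is the cardinality of [K]. *)
Definition succ_saturated (X : Type) (K : set X) :=
  forall (A : set M) p, A #<= K -> complete_type A p -> exists x, realizes x p.

End Geometry.

(* For a complete theory the condition does not depend on the choice of the
   |T|^+-saturated model. *)
Definition nowhere_trivial (L : language) (T : set (formula L 0)) : Prop :=
  exists (N : Type) (s : structure L N),
    [/\ T `<=` Th s, succ_saturated s T &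
      forall (A : set N) (p : set (pformula L N 1)),
        A #<= T -> complete_type s A p -> nonalgebraic s p ->
        exists2 x, realizes s x p &
          exists k (b : 'I_k -> N) l (c : 'I_l -> N),
            [/\ indep_from s (single x) A (range b),
                indep_from s (single x) A (range c)
              & acl s (A `|` range b `|` range c) x]].

Definition asymptotic_class (R : realType) (L : language)
    (C : forall N : finType, structure L N -> Prop) : Prop :=
  forall n (phi : formula L (1 + n)),
  let count (N : finType) (s : structure L N) (a : 'I_n -> N) : R :=
    #|[set x : N | `[< sat s phi (fcat (single x) a) >]]%SET|%:R in
  exists (c : R) (E : seq R),
  let close mu (N : finType) (s : structure L N) (a : 'I_n -> N) :=
    `|count N s a - mu * #|N|%:R| <= c * Num.sqrt #|N|%:R in
  [/\ 0 < c,
      forall mu, mu \in E -> 0 < mu,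
      forall (N : finType) (s : structure L N), C N s -> forall a,
        count N s a <= c \/ exists2 mu, mu \in E & close mu N s a
    & forall mu, mu \in E -> exists phi_mu : formula L n,
        forall (N : finType) (s : structure L N), C N s -> forall a,
          sat s phi_mu a <-> close mu N s a].

Section HStructures.
Variable L : language.

(* The symbol H is [None]. *)
Definition LH : language :=
  @Language (fsym L) (@far L) (option (rsym L)) (oapp (@rar L) 1%N).

Definition expandH M (s : structure L M) (H : set M) : structure LH M :=
  @Structure LH M (fint s)
    (fun r : option (rsym L) =>
       match r return ('I_(oapp (@rar L) 1%N r) -> M) -> Prop with
       | Some r' => rint s r'
       | None => fun v => H (v ord0)
       end)
    (str_inh s).

Definition Hset M (s : structure LH M) : set M :=
  [set x | rint s None (single x)].

Definition H_structure M (s : structure L M) (H : set M) : Prop :=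
  alg_indep_set s H /\
  forall (A : set M) (p : set (pformula L M 1)),
    finite_dim s A -> complete_type s A p -> nonalgebraic s p ->
    (exists2 x, H x & realizes s x p) /\
    (exists2 x, ~ acl s (A `|` H) x & realizes s x p).

Definition ldim M (s : structure L M) (H : set M) n (a : 'I_n -> M)
    (A : set M) : nat :=
  dim s a (A `|` H).

End HStructures.

Section Ultraproduct.
Variables (I : Type) (U : set_system I) (FU : UltraFilter U).

Definition ufamily (M : I -> Type) := forall i, M i.

HB.instance Definition _ M := gen_eqMixin (ufamily M).
HB.instance Definition _ M := gen_choiceMixin (ufamily M).

Definition ueq (M : I -> Type) (x y : ufamily M) : bool :=
  `[< \forall i \near U, x i = y i >].

Fact ueq_refl M : reflexive (@ueq M).
Proof. by move=> x; apply/asboolP; apply: nearW. Qed.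

Fact ueq_sym M : symmetric (@ueq M).
Proof.
by move=> x y; apply/asboolP/asboolP; apply: filterS => i ->.
Qed.

Fact ueq_trans M : transitive (@ueq M).
Proof.
move=> y x z /asboolP xy /asboolP yz; apply/asboolP.
by apply: filterS2 xy yz => i -> ->.
Qed.

Canonical ueq_equiv M := EquivRel (@ueq M) (@ueq_refl M) (@ueq_sym M) (@ueq_trans M).

Definition ultraproduct (M : I -> Type) : Type := {eq_quot (ueq_equiv M)}.

Definition upi M (x : ufamily M) : ultraproduct M := \pi_{eq_quot (ueq_equiv M)} x.

Definition urepr M (x : ultraproduct M) : ufamily M :=
  repr (x : {eq_quot (ueq_equiv M)}).

Fact ultra_inh (M : I -> Type) :
  (forall i, inhabited (M i)) -> inhabited (ultraproduct M).
Proof.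
move=> inhM; have inhM' i : exists _ : M i, True by case: (inhM i) => y; exists y.
by constructor; exact: (upi (fun i => sval (cid (inhM' i)))).
Qed.

(* Interpretations are computed on chosen representatives; any other choice
   agrees with it for U-almost all i. *)
Definition ultra_str (L : language) (M : I -> Type)
    (s : forall i, structure L (M i)) : structure L (ultraproduct M) :=
  @Structure L (ultraproduct M)
    (fun f v => upi (fun i => fint (s i) f (fun j => urepr (v j) i)))
    (fun r v => \forall i \near U, rint (s i) r (fun j => urepr (v j) i))
    (ultra_inh (fun i => str_inh (s i))).

End Ultraproduct.

Section CoarseDimension.
Variables (R : realType) (I : Type) (U : set_system I) (FU : UltraFilter U).
Variable M : I -> finType.

(* delta_M of the internal set which is the ultraproduct of the X i, where
   X i is a set of elements or of tuples of M i.  The limit is the limit along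
   the ultrafilter U.  As [ln 0 = 0], this is the usual value only if the X i
   are nonempty for U-almost all i; below, delta is only taken of nonempty
   sets. *)
Definition delta (T : I -> finType) (X : forall i, {set T i}) : R :=
  lim ((fun i => ln (#|X i|%:R : R) / ln (#|M i|%:R : R)) @ U).

Variables (L : language) (s : forall i, structure L (M i)).
Variable (H : forall i, {set M i}).

Definition finite_pairs i : structure (LH L) (M i) :=
  expandH (s i) [set` H i].

Definition upair : structure (LH L) (ultraproduct FU M) :=
  ultra_str FU finite_pairs.

(* X(M_i), for the subset X of M^n defined by the L_H-formula [f]. *)
Definition defset n (f : pformula (LH L) (ultraproduct FU M) n) i :
    {set {ffun 'I_n -> M i}} :=
  [set x : {ffun 'I_n -> M i} |
    `[< sat (finite_pairs i) (pf_form f)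
            (fcat x (fun j => urepr (pf_par f j) i)) >]].

Definition delta_tuple n (a : 'I_n -> ultraproduct FU M)
    (A : set (ultraproduct FU M)) : R :=
  inf [set delta (defset f) | f in
    [set f : pformula (LH L) (ultraproduct FU M) n | params_in A f /\ psat upair f a]].

End CoarseDimension.

(* Main.v *)
Require Import Defs.
From HB Require Import structures.
From mathcomp Require Import all_boot all_order all_algebra.
From mathcomp Require Import generic_quotient.
From mathcomp Require Import all_classical all_reals all_analysis.
From mathcomp Require Import zify ring lra.

(** Write N for the ultraproduct, H for its distinguished subset and d for
    ldim(a/A).  By exchange, a has a subtuple a_J of length d, independent over
    A and H, over which together with A and H all of a is algebraic
    ([dim_basis]).  Everything rests on tameness: uniformly in the parameters and
    for almost all i, an L-formula in one variable has at most k solutions in M_i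
    or at least #|M_i| / k ([asymptotic_tame]).  Exchange follows from it by
    counting pairs ([exchange]).

    Upper bound.  Each entry a_c satisfies an algebraic formula over a_J, some
    alpha in A and a tuple h in H.  Quantifying h over H and taking the
    conjunction over c gives an L_H-formula over A satisfied by a.  For given x_J
    it allows at most k * #|H_i| ^ m values of x_c, and the powers of #|H_i| are
    negligible against #|M_i| because delta(H) = 0; so the set it defines has
    coarse dimension at most d ([spanned_bound]).

    Lower bound.  Let an L_H-formula over A define a set X containing a, and
    suppose that delta(X) < d.  Then the projection of X to the coordinates in J
    is thin: it is smaller than #|M_i| ^ d by more than any constant factor.  A
    tuple a'_J outside this projection is built which satisfies the same
    L_H-formulas as a_J; this is absurd ([defset_not_thin]).  Two ingredients:

    - [generic_tuple] chooses a'_J one coordinate at a time.  A definable set of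
      positive proportion is not covered by finitely many thin sets, so countable
      saturation yields an element with a prescribed non-algebraic type outside
      countably many thin sets.  The elements algebraic over the parameters and H
      form such sets, so the new element is independent of H; by Fubini so do the
      elements over which the fibre of the projection is not thin.

    - [alike_sat] is a back-and-forth argument: two tuples with the same L-type,
      and with entries in H at the same places, satisfy the same L_H-formulas if
      each is independent from H over its entries in H.  An element of H is
      answered in H, by the density of H ([realize_in_reduct]); an algebraic
      element is answered by a conjugate; an element algebraic over the tuple and
      H reduces to these two cases; any other element is answered generically, as
      above.

    The language may be uncountable, whereas an ultraproduct need only be
    saturated for countable sets of formulas.  The lower bound is therefore
    proved in the countable sublanguage of the symbols of one formula. *)

Set Implicit Arguments.
Unset Strict Implicit.
Unset Printing Implicit Defensive.

Import Order.TTheory GRing.Theory Num.Theory numFieldNormedType.Exports.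

Local Open Scope classical_set_scope.
Local Open Scope ring_scope.

Local Notation eval := Defs.eval.
Local Notation fsym := Defs.fsym.

(** * Tuples *)

Notation "x .: v" := (fcat (single x) v) (at level 35, right associativity).

Section Concatenation.
Variable T : Type.

Lemma fcatl k m (x : 'I_k -> T) (y : 'I_m -> T) i : fcat x y (lshift m i) = x i.
Proof. by rewrite /fcat (unsplitK (inl i)). Qed.

Lemma fcatr k m (x : 'I_k -> T) (y : 'I_m -> T) i : fcat x y (rshift k i) = y i.
Proof. by rewrite /fcat (unsplitK (inr i)). Qed.

Lemma eq_fcat k m (f g : 'I_(k + m) -> T) :
  (forall i, f (lshift m i) = g (lshift m i)) ->
  (forall i, f (rshift k i) = g (rshift k i)) -> f = g.
Proof.
by move=> fgl fgr; apply/funext => i; case: (split_ordP i) => j ->.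
Qed.

End Concatenation.

Section Tuples.
Variable T : Type.

Lemma cons_head n (x : T) (v : 'I_n -> T) : (x .: v) ord0 = x.
Proof.
have -> : ord0 = lshift n (ord0 : 'I_1) :> 'I_(1 + n) by exact/val_inj.
by rewrite fcatl.
Qed.

Lemma fcatA k m n (x : 'I_k -> T) (y : 'I_m -> T) (z : 'I_n -> T) (e : (k + (m + n) = k + m + n)%N) :
  fcat x (fcat y z) = fcat (fcat x y) z \o cast_ord e.
Proof.
apply: eq_fcat => i /=.
  rewrite fcatl; have -> : cast_ord e (lshift (m + n) i) = lshift n (lshift m i).
    exact/val_inj.
  by rewrite !fcatl.
rewrite fcatr; case: (split_ordP i) => j ->.
  rewrite fcatl; have -> : cast_ord e (rshift k (lshift n j)) = lshift n (rshift k j).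
    exact/val_inj.
  by rewrite fcatl fcatr.
rewrite fcatr; have -> : cast_ord e (rshift k (rshift m j)) = rshift (k + m) j.
  by apply/val_inj => /=; rewrite addnA.
by rewrite fcatr.
Qed.

Lemma cons_fcat m n (x : T) (y : 'I_m -> T) (z : 'I_n -> T) :
  x .: fcat y z = fcat (x .: y) z.
Proof.
rewrite (fcatA _ _ _ (erefl (1 + (m + n))%N)); apply/funext => i /=.
by congr (fcat _ _ _); exact/val_inj.
Qed.

Lemma fcat_comp U (f : T -> U) k m (x : 'I_k -> T) (y : 'I_m -> T) :
  f \o fcat x y = fcat (f \o x) (f \o y).
Proof. by apply: eq_fcat => i /=; rewrite !(fcatl, fcatr). Qed.

Lemma cons_comp U (f : T -> U) m (x : T) (y : 'I_m -> T) :
  f \o (x .: y) = f x .: (f \o y).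
Proof. by rewrite fcat_comp. Qed.

Lemma fcat_nil n (x : 'I_0 -> T) (v : 'I_n -> T) : fcat x v = v.
Proof.
have := @eq_fcat T 0 n (fcat x v) v; apply => [[]//|i]; rewrite fcatr.
by congr v; exact/val_inj.
Qed.

Lemma cons_eta n (v : 'I_(1 + n) -> T) : v = v ord0 .: (v \o @rshift 1 n).
Proof.
apply: eq_fcat => i; rewrite !(fcatl, fcatr) // /single.
by congr v; apply/val_inj; rewrite ord1.
Qed.

End Tuples.

(** How a renaming passes under a quantifier: the bound variable is kept, the
    others are shifted. *)
Lemma cons_ren T n m (x : T) (v : 'I_m -> T) (r : 'I_n -> 'I_m) :
  (x .: v) \o ((ord0 : 'I_(1 + m)) .: (@rshift 1 m \o r)) = x .: (v \o r).
Proof.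
rewrite cons_comp; congr fcat; last by apply/funext => i /=; rewrite fcatr.
by apply/funext => i; rewrite /single cons_head.
Qed.

(** * Counting quantifiers *)

Section AtLeast.

(** The recursion, rather than an injection of 'I_k into S, is the one by which
    a first-order formula says that there are at least k solutions. *)
Fixpoint atleast T k (S : set T) : Prop :=
  if k is k'.+1 then exists2 y, S y & atleast k' (S `\ y) else True.

Lemma atleastS T k (S S' : set T) : S `<=` S' -> atleast k S -> atleast k S'.
Proof.
elim: k S S' => //= k IH S S' SS' [y Sy H]; exists y; first exact: SS'.
by apply: IH H => z [Sz zy]; split=> //; exact: SS'.
Qed.

Lemma atleast_card (T : finType) k (S : set T) :
  atleast k S <-> (k <= #|[set x | `[< S x >]]%SET|)%N.
Proof.
elim: k S => //= k IH S; split=> [[y Sy /IH]|].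
  rewrite (cardsD1 y [set x | `[< S x >]]%SET) inE asboolT//= add1n ltnS.
  move=> /leq_trans; apply; apply/subset_leq_card/fintype.subsetP => z.
  by rewrite !inE => -[Sz zy]; rewrite asboolT// andbT; apply/eqP.
move=> h; have /card_gt0P[y] : (0 < #|[set x | `[< S x >]]%SET|)%N by exact: (leq_ltn_trans (leq0n k) h).
rewrite inE => /asboolP Sy; exists y => //; apply/IH.
move: h; rewrite (cardsD1 y) inE asboolT//= add1n ltnS => /leq_trans; apply.
apply/subset_leq_card/fintype.subsetP => z; rewrite !inE => /andP[zy /asboolP Sz].
by split=> // /eqP; rewrite (negbTE zy).
Qed.

Lemma infinite_atleast T (S : set T) : infinite_set S -> forall k, atleast k S.
Proof.
move=> + k; elim: k S => //= k IH S inf.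
have [y Sy] := infinite_setN0 inf; exists y => //.
by apply: IH; apply: infinite_setD => //; exact: finite_set1.
Qed.

Lemma atleast_seq (T : eqType) k (S : set T) (r : seq T) :
  S `<=` [set` r] -> atleast k S -> (k <= size r)%N.
Proof.
elim: k S r => //= k IH S r Sr [y Sy H].
have yr : (0 < count_mem y r)%N by rewrite -has_count has_pred1; exact: (Sr _ Sy).
rewrite -(count_predC (pred1 y)) -add1n; apply: leq_add => //.
rewrite -size_filter; apply: IH H => x [/Sr /= xr xy].
by rewrite mem_filter /= xr andbT; apply/eqP.
Qed.

Lemma finite_atleast T (S : set T) : finite_set S <-> exists k, ~ atleast k S.
Proof.
split; last by move=> [k nk]; apply: contrapT => /infinite_atleast/(_ k).
elim/Pchoice: T => T in S *.
move=> /finite_seqP[r ->]; exists (size r).+1 => h.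
by have := atleast_seq (@subset_refl _ [set` r]) h; rewrite ltnn.
Qed.

End AtLeast.

(** * Definable relations *)

Section Definable.

(** A formula up to equivalence.  Closure under logical operations is proved on
    the semantic side, and one relation can be read both in the ultraproduct and
    in its factors. *)
Definition relation L n := forall M : Type, structure L M -> ('I_n -> M) -> Prop.

Definition definable L n (P : relation L n) :=
  exists phi : formula L n, forall M (s : structure L M) v, sat s phi v <-> P M s v.

Variable L : language.

Lemma definable_sat n (phi : formula L n) : definable (fun M (s : structure L M) => sat s phi).
Proof. by exists phi. Qed.

Lemma definable_iff n (P Q : relation L n) :
  (forall M (s : structure L M) v, P M s v <-> Q M s v) -> definable P -> definable Q.
Proof.
by move=> PQ [phi h]; exists phi => M s v; split; [move/h/PQ|move/PQ/h].
Qed.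

Lemma definable_imp n (P Q : relation L n) : definable P -> definable Q ->
  definable (fun M s v => P M s v -> Q M s v).
Proof.
move=> [p pP] [q qQ]; exists (Imp p q) => M s v /=.
by split=> h /pP/h/qQ.
Qed.

Lemma definable_false n : definable (fun M (s : structure L M) (v : 'I_n -> M) => False).
Proof. by exists (Fal L n). Qed.

Lemma definable_not n (P : relation L n) : definable P ->
  definable (fun M s v => ~ P M s v).
Proof. by move=> dP; apply: definable_imp (definable_false _). Qed.

Lemma definable_and n (P Q : relation L n) : definable P -> definable Q ->
  definable (fun M s v => P M s v /\ Q M s v).
Proof.
move=> dP dQ.
apply: definable_iff (definable_not (definable_imp dP (definable_not dQ))) => M s v /=.
split=> [h|[p q] h]; last exact: h.
by apply: contrapT => pq; apply: h => p q; apply: pq.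
Qed.

Lemma definable_forall n (P : relation L (1 + n)) : definable P ->
  definable (fun M s (v : 'I_n -> M) => forall x, P M s (x .: v)).
Proof.
by move=> [p pP]; exists (All p) => M s v /=; split=> h x; apply/pP.
Qed.

Lemma definable_exists n (P : relation L (1 + n)) : definable P ->
  definable (fun M s (v : 'I_n -> M) => exists x, P M s (x .: v)).
Proof.
move=> dP; apply: definable_iff (definable_not (definable_forall (definable_not dP))).
move=> M s v /=; split=> [|[x Px] h]; last exact: h Px.
by move=> h; apply: contrapT => /forallNP.
Qed.

Lemma definable_eq n (i j : 'I_n) : definable (fun M (s : structure L M) v => v i = v j).
Proof. by exists (Equ (Var L i) (Var L j)). Qed.

Lemma term_ren n m (r : 'I_n -> 'I_m) (t : term L n) : exists t' : term L m,
  forall M (s : structure L M) v, eval s v t' = eval s (v \o r) t.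
Proof.
elim: t => [i|f u /choice[u' u'E]]; first by exists (Var L (r i)).
by exists (App u') => M s v /=; congr fint; apply/funext.
Qed.

Lemma definable_ren n (P : relation L n) m (r : 'I_n -> 'I_m) : definable P ->
  definable (fun M (s : structure L M) v => P M s (v \o r)).
Proof.
suff ren phi : definable (fun M (s : structure L M) v => sat s phi (v \o r)).
  by move=> [p pP]; apply: definable_iff (ren p) => M s v; exact: pP.
elim: phi m r => {n P} [n|n t u|n R u|n p IHp q IHq|n p IHp] m r /=.
- exact: definable_false.
- have [[t' t'E] [u' u'E]] := (term_ren r t, term_ren r u).
  by exists (Equ t' u') => M s v /=; rewrite t'E u'E.
- have /choice[u' u'E] := fun j => term_ren r (u j).
  exists (Rel u') => M s v /=.
  by rewrite (_ : (fun j => _) = fun j => eval s (v \o r) (u j)) //; apply/funext.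
- exact: definable_imp.
- apply: definable_iff (definable_forall (IHp _ ((ord0 : 'I_(1 + m)) .: (@rshift 1 m \o r)))).
  by move=> M s v; split=> h x; move: (h x); rewrite cons_ren.
Qed.

(** Having k + 1 solutions means that some solution y leaves k solutions distinct
    from y; Q is the latter condition, in the variables x, y and v. *)
Lemma definable_atleast k n (P : relation L (1 + n)) : definable P ->
  definable (fun M s (v : 'I_n -> M) => atleast k [set x | P M s (x .: v)]).
Proof.
elim: k n P => [|k IH] n P dP /=.
  exact: definable_iff (definable_imp (definable_false _) (definable_false _)).
pose Q : relation L (1 + (1 + n)) := fun M s w =>
  P M s (w \o ((ord0 : 'I_(1 + (1 + n))) .: (@rshift 1 _ \o @rshift 1 n)))
  /\ ~ (w ord0 = w (@rshift 1 (1 + n) ord0)).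
have dQ : definable Q.
  apply: definable_and; first exact: definable_ren.
  exact/definable_not/definable_eq.
apply: definable_iff (definable_exists (definable_and dP (IH _ _ dQ))).
move=> M s v /=.
have QE x y : Q M s (x .: y .: v) <-> P M s (x .: v) /\ x <> y.
  rewrite /Q cons_ren cons_head fcatr cons_head.
  rewrite (_ : (y .: v) \o _ = v) //.
  by apply/funext => i /=; rewrite fcatr.
split=> [[y []]|[y ]] Py H; exists y => //; [|split=> //];
  by apply: atleastS H => x /QE.
Qed.

End Definable.

(** * Change of language *)

Section Symbols.
Variable L : language.

Fixpoint term_fsyms n (t : term L n) : set (fsym L) :=
  match t with
  | Var _ => set0
  | App f u => [set f] `|` \bigcup_j term_fsyms (u j)
  end.

Fixpoint formula_fsyms n (phi : formula L n) : set (fsym L) :=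
  match phi with
  | Fal _ => set0
  | Equ _ t u => term_fsyms t `|` term_fsyms u
  | Rel _ _ u => \bigcup_j term_fsyms (u j)
  | Imp _ p q => formula_fsyms p `|` formula_fsyms q
  | All _ p => formula_fsyms p
  end.

Fixpoint formula_rsyms n (phi : formula L n) : set (rsym L) :=
  match phi with
  | Fal _ => set0
  | Equ _ t u => set0
  | Rel _ r u => [set r]
  | Imp _ p q => formula_rsyms p `|` formula_rsyms q
  | All _ p => formula_rsyms p
  end.

Lemma countable_setU T (A B : set T) : countable A -> countable B -> countable (A `|` B).
Proof.
move=> cA cB; rewrite -bigcup2E; apply: bigcup_countable => // i _.
by case: i => [|[|i]] //=.
Qed.

Lemma term_fsyms_countable n (t : term L n) : countable (term_fsyms t).
Proof.
elim: t => [i|f u IH] /=; first exact: countable0.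
apply: countable_setU; first exact: countable1.
by apply: bigcup_countable => // j _; exact: IH.
Qed.

Lemma formula_fsyms_countable n (phi : formula L n) : countable (formula_fsyms phi).
Proof.
elim: phi => {n} [n|n t u|n r u|n p IHp q IHq|n p IHp] //=.
- by apply: countable_setU; exact: term_fsyms_countable.
- by apply: bigcup_countable => // j _; exact: term_fsyms_countable.
- exact: countable_setU.
Qed.

Lemma formula_rsyms_countable n (phi : formula L n) : countable (formula_rsyms phi).
Proof.
elim: phi => {n} [n|n t u|n r u|n p IHp q IHq|n p IHp] //=.
exact: countable_setU.
Qed.

End Symbols.

Section Transfer.
Variables (L1 L2 : language).
Variable R : forall M : Type, structure L1 M -> structure L2 M -> Prop.

(** R relates the structures, on a common carrier, between which formulas are
    translated; a translation is known as soon as atoms can be translated. *)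
Definition fsym_transfers (f : fsym L1) := forall n (u : 'I_(far f) -> term L2 n),
  exists t : term L2 n, forall M (s1 : structure L1 M) (s2 : structure L2 M) v, R s1 s2 ->
    eval s2 v t = fint s1 f (fun j => eval s2 v (u j)).

Definition rsym_transfers (r : rsym L1) := forall n (u : 'I_(rar r) -> term L2 n),
  exists phi : formula L2 n, forall M (s1 : structure L1 M) (s2 : structure L2 M) v, R s1 s2 ->
    (sat s2 phi v <-> rint s1 r (fun j => eval s2 v (u j))).

Lemma term_transfer n (t : term L1 n) : term_fsyms t `<=` fsym_transfers ->
  exists t' : term L2 n, forall M (s1 : structure L1 M) (s2 : structure L2 M) v,
    R s1 s2 -> eval s2 v t' = eval s1 v t.
Proof.
elim: t => [i|f u IH] /= ft; first by exists (Var L2 i).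
have /choice[u' u'E] := fun j => IH j (fun g gu => ft g (or_intror (ex_intro2 _ _ j I gu))).
have [t' t'E] := ft f (or_introl erefl) n u'.
exists t' => M s1 s2 v s12; rewrite (t'E _ _ _ _ s12); congr fint.
by apply/funext => j; exact: u'E.
Qed.

Lemma formula_transfer n (phi : formula L1 n) :
  formula_fsyms phi `<=` fsym_transfers -> formula_rsyms phi `<=` rsym_transfers ->
  exists psi : formula L2 n, forall M (s1 : structure L1 M) (s2 : structure L2 M) v,
    R s1 s2 -> (sat s2 psi v <-> sat s1 phi v).
Proof.
elim: phi => {n} [n|n t u|n r u|n p IHp q IHq|n p IHp] /= ft rt.
- by exists (Fal L2 n).
- have [t' t'E] := @term_transfer n t (fun g gt => ft g (or_introl gt)).
  have [u' u'E] := @term_transfer n u (fun g gu => ft g (or_intror gu)).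
  by exists (Equ t' u') => M s1 s2 v s12 /=; rewrite (t'E _ s1)// (u'E _ s1).
- have /choice[u' u'E] := fun j => @term_transfer n (u j)
    (fun g gu => ft g (ex_intro2 _ _ j I gu)).
  have [psi psiE] := rt r erefl n u'; exists psi => M s1 s2 v s12.
  rewrite (psiE _ _ _ _ s12); rewrite (_ : (fun j => _) = fun j => eval s1 v (u j)) //.
  by apply/funext => j; exact: u'E.
- have [p' p'E] := IHp (fun g gt => ft g (or_introl gt)) (fun g gt => rt g (or_introl gt)).
  have [q' q'E] := IHq (fun g gt => ft g (or_intror gt)) (fun g gt => rt g (or_intror gt)).
  by exists (Imp p' q') => M s1 s2 v s12 /=; rewrite (p'E _ s1)// (q'E _ s1).
- have [p' p'E] := IHp ft rt; exists (All p') => M s1 s2 v s12 /=.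
  by split=> h x; have := h x; rewrite (p'E _ s1).
Qed.

End Transfer.

Section Reducts.
Variable L : language.

Definition sublanguage (F : set (fsym L)) (G : set (rsym L)) : language :=
  @Language {f | F f} (fun f => far (sval f)) {r | G r} (fun r => rar (sval r)).

Definition reduct F G M (s : structure L M) : structure (sublanguage F G) M :=
  @Structure (sublanguage F G) M (fun f => fint s (sval f)) (fun r => rint s (sval r)) (str_inh s).

Definition forget_H M (s : structure (LH L) M) : structure L M :=
  @Structure L M (fint s) (fun r => rint s (Some r)) (str_inh s).

Lemma definable_reduct F G n (phi : formula (sublanguage F G) n) :
  definable (fun M (s : structure L M) v => sat (reduct F G s) phi v).
Proof.
have [||psi psiE] := @formula_transfer _ L
    (fun M s1 s2 => s1 = reduct F G s2) n phi.
- by move=> f _ m u; exists (App (f := sval f) u) => M s1 s2 v ->.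
- by move=> r _ m u; exists (Rel (r := sval r) u) => M s1 s2 v ->.
by exists psi => M s v; exact: psiE.
Qed.

Lemma definable_forget_H n (phi : formula L n) :
  definable (fun M (s : structure (LH L) M) v => sat (forget_H s) phi v).
Proof.
have [||psi psiE] := @formula_transfer L (LH L) (fun M s1 s2 => s1 = forget_H s2) n phi.
- by move=> f _ m u; exists (@App (LH L) m f u) => M s1 s2 v ->.
- by move=> r _ m u; exists (@Rel (LH L) m (Some r) u) => M s1 s2 v ->.
by exists psi => M s v; exact: psiE.
Qed.

Lemma sat_congr n (phi : formula L n) M (s s' : structure L M) v :
  fint s = fint s' -> rint s = rint s' -> sat s phi v <-> sat s' phi v.
Proof.
case: s s' => f r i [f' r' i'] /= ff rr; rewrite ff rr.
by rewrite (Prop_irrelevance i i').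
Qed.

End Reducts.

(** * Łoś's theorem *)

Section Los.
Variables (I : Type) (U : set_system I) (FU : UltraFilter U) (M : I -> Type).

Lemma ultra_dec (P : I -> Prop) : (\forall i \near U, P i) \/ (\forall i \near U, ~ P i).
Proof. exact: in_ultra_setVsetC. Qed.

Lemma near_not (P : I -> Prop) : (\forall i \near U, ~ P i) <-> ~ (\forall i \near U, P i).
Proof.
split=> [nP nQ|nP]; last by case: (ultra_dec P).
by have [] := filter_ex (filterI nP nQ) => i [].
Qed.

Lemma near_all_ord n (P : 'I_n -> I -> Prop) :
  (forall j, \forall i \near U, P j i) -> \forall i \near U, forall j, P j i.
Proof. by move=> h; exact: filter_forall. Qed.

Lemma urepr_upi (x : ufamily M) : \forall i \near U, urepr (upi FU x) i = x i.
Proof. by have /eqquotP/asboolP := reprK (upi FU x). Qed.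

Lemma upi_urepr (x : ultraproduct FU M) : upi FU (urepr x) = x.
Proof. exact: reprK. Qed.

Lemma upi_eq (x y : ufamily M) : upi FU x = upi FU y <-> \forall i \near U, x i = y i.
Proof. by split=> [/eqquotP/asboolP//|h]; apply/eqquotP/asboolP. Qed.

Lemma urepr_eq (x y : ultraproduct FU M) : x = y <-> \forall i \near U, urepr x i = urepr y i.
Proof. by rewrite -upi_eq !upi_urepr. Qed.

Definition slice n (v : 'I_n -> ultraproduct FU M) i : 'I_n -> M i := fun j => urepr (v j) i.

Lemma slice_fcat n m (v : 'I_n -> ultraproduct FU M) (w : 'I_m -> ultraproduct FU M) i :
  slice (fcat v w) i = fcat (slice v i) (slice w i).
Proof. exact: (@fcat_comp _ _ (fun x => urepr x i)). Qed.

Lemma slice_cons n x (v : 'I_n -> ultraproduct FU M) i :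
  slice (x .: v) i = urepr x i .: slice v i.
Proof. exact: slice_fcat. Qed.

Variables (L : language) (s : forall i, structure L (M i)).

Lemma eval_ultra n (v : 'I_n -> ultraproduct FU M) (t : term L n) :
  eval (ultra_str FU s) v t = upi FU (fun i => eval (s i) (slice v i) t).
Proof.
elim: t => [j|f u IH] /=; first by rewrite /slice upi_urepr.
apply/upi_eq; have := near_all_ord (fun j => urepr_upi (fun i => eval (s i) (slice v i) (u j))).
apply: filterS => i h; congr fint; apply/funext => j.
by rewrite IH.
Qed.

Lemma eval_slice n (v : 'I_n -> ultraproduct FU M) (t : term L n) :
  \forall i \near U, urepr (eval (ultra_str FU s) v t) i = eval (s i) (slice v i) t.
Proof. by rewrite eval_ultra; exact: urepr_upi. Qed.

Theorem los n (phi : formula L n) (v : 'I_n -> ultraproduct FU M) :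
  sat (ultra_str FU s) phi v <-> \forall i \near U, sat (s i) phi (slice v i).
Proof.
elim: phi v => {n} [n|n t u|n r u|n p IHp q IHq|n p IHp] v /=.
- by split=> // /filter_ex[].
- rewrite urepr_eq; have ht := eval_slice v t; have hu := eval_slice v u.
  by split=> h; apply: filterS3 ht hu h => i -> ->.
- have hu := near_all_ord (fun j => eval_slice v (u j)).
  split=> h; apply: filterS2 hu h => i hi.
    by rewrite (_ : (fun j => _) = fun j => eval (s i) (slice v i) (u j)) //; apply/funext.
  by rewrite (_ : (fun j => _) = fun j => eval (s i) (slice v i) (u j)) //; apply/funext.
- rewrite IHp IHq; split=> [h|h hp]; last by apply: filterS2 h hp => i; apply.
  case: (ultra_dec (fun i => sat (s i) p (slice v i))) => [/[dup] hp /h|hp].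
    exact: filterS.
  by apply: filterS hp => i.
- split=> [h|h x]; last first.
    by rewrite IHp; apply: filterS h => i; rewrite slice_cons.
  apply: contrapT => /near_not nh.
  have ex i : exists x, (exists x, ~ sat (s i) p (x .: slice v i)) -> ~ sat (s i) p (x .: slice v i).
    case: (pselect (exists x, ~ sat (s i) p (x .: slice v i))) => [[x xP]|nx]; first by exists x.
    by case: (str_inh (s i)) => x; exists x.
  pose x i := sval (cid (ex i)); have xP i : _ -> ~ sat (s i) p (x i .: slice v i) := svalP (cid (ex i)).
  have := h (upi FU x); rewrite IHp => hx.
  have [i [ni [hi ei]]] := filter_ex (filterI nh (filterI hx (urepr_upi x))).
  move: hi; rewrite slice_cons ei; apply: xP.
  by apply: contrapT => /forallNP/= ny; apply: ni => y; apply: contrapT; exact: ny.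
Qed.

Definition internal n (P : relation L n) : Prop :=
  forall v : 'I_n -> ultraproduct FU M, P _ (ultra_str FU s) v <->
    \forall i \near U, P _ (s i) (slice v i).

Lemma los_definable n (P : relation L n) : definable P -> internal P.
Proof.
move=> [p pP] v; rewrite -pP los; by split; apply: filterS => i /=; rewrite pP.
Qed.

End Los.

(** * Algebraic closure *)

Section Acl.
Variable L : language.

Definition bounded n k (P : relation L (1 + n)) :=
  forall M (s : structure L M) v, ~ atleast k [set x | P M s (x .: v)].

(** The conjunction of P with the statement that P has fewer than k solutions in
    its first variable.  The bound then holds in every structure, so that it can
    be used in the factors of an ultraproduct. *)
Definition trim n k (P : relation L (1 + n)) : relation L (1 + n) := fun M s w =>
  P M s w /\ ~ atleast k [set y | P M s (y .: (w \o @rshift 1 n))].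

Lemma cons_tail T n (x : T) (v : 'I_n -> T) : (x .: v) \o @rshift 1 n = v.
Proof. by apply/funext => i /=; rewrite fcatr. Qed.

Lemma definable_trim n k (P : relation L (1 + n)) : definable P -> definable (trim k P).
Proof.
move=> dP; apply: definable_and => //.
exact: (definable_ren _ (definable_not (definable_atleast k dP))).
Qed.

Lemma trim_cons n k (P : relation L (1 + n)) M (s : structure L M) x v :
  trim k P s (x .: v) <-> P M s (x .: v) /\ ~ atleast k [set y | P M s (y .: v)].
Proof. by rewrite /trim cons_tail. Qed.

Variables (N : Type) (s : structure L N).
Implicit Types B C : set N.

Lemma trim_bounded n k (P : relation L (1 + n)) : (0 < k)%N -> bounded k (trim k P).
Proof.
move=> k0 M t v h.
have [x] : exists x, trim k P t (x .: v).
  by case: k k0 h => //= k _ [y Py _]; exists y.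
move=> /trim_cons[_]; apply; apply: atleastS h => y /trim_cons[] //.
Qed.

(** Sorts the parameters by their origin, so that a formula can be rewritten with
    one tuple of parameters from each set. *)
Lemma split_params B C m (p : 'I_m -> N) : (forall i, (B `|` C) (p i)) ->
  exists n1 (b : 'I_n1 -> N) n2 (c : 'I_n2 -> N) (r : 'I_m -> 'I_(n1 + n2)),
    [/\ forall i, B (b i), forall i, C (c i) & p = fcat b c \o r].
Proof.
move=> BCp; pose SB := [set i | `[< B (p i) >]]%SET; pose SC := [set i | `[< C (p i) >]]%SET.
exists #|SB|, (p \o enum_val), #|SC|, (p \o enum_val).
have /choice[r rE] : forall i, exists k : 'I_(#|SB| + #|SC|),
    p i = fcat (p \o @enum_val _ (mem SB)) (p \o @enum_val _ (mem SC)) k.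
  move=> i; case: (BCp i) => h.
    have iS : i \in SB by rewrite inE; exact/asboolP.
    by exists (lshift _ (enum_rank_in iS i)); rewrite fcatl /= enum_rankK_in.
  have iS : i \in SC by rewrite inE; exact/asboolP.
  by exists (rshift _ (enum_rank_in iS i)); rewrite fcatr /= enum_rankK_in.
exists r; split=> [i|i|]; last exact/funext.
- by have := enum_valP i; rewrite inE => /asboolP.
- by have := enum_valP i; rewrite inE => /asboolP.
Qed.

Lemma acl_sub B C : B `<=` C -> acl s B `<=` acl s C.
Proof. by move=> BC x [f [fB ff fx]]; exists f; split=> // i; exact/BC/fB. Qed.

Lemma acl_intro n (b : 'I_n -> N) (P : relation L (1 + n)) B x :
  definable P -> (forall i, B (b i)) -> finite_set [set y | P N s (y .: b)] ->
  P N s (x .: b) -> acl s B x.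
Proof.
move=> [phi phiP] Bb fin Px; exists (@PFormula L N 1 n phi b); split=> //; last exact/phiP.
by apply: sub_finite_set fin => y /phiP.
Qed.

Lemma aclE B x : acl s B x -> exists n (b : 'I_n -> N) k (P : relation L (1 + n)),
  [/\ definable P, bounded k P, forall i, B (b i) & P N s (x .: b)].
Proof.
move=> [[n phi b] [/= Bb /finite_atleast[k nk] xphi]].
have k0 : (0 < k)%N by case: k nk => // nk; case: nk.
exists n, b, k, (trim k (fun M (t : structure L M) => sat t phi)); split=> //.
- exact/definable_trim/definable_sat.
- exact: trim_bounded.
- exact/trim_cons.
Qed.

Lemma acl_incl B : B `<=` acl s B.
Proof.
move=> x Bx; apply: (@acl_intro 1 (single x) _ _ _ (definable_eq L ord0 (@rshift 1 1 ord0))) => //.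
  apply: (sub_finite_set _ (finite_set1 x)) => y /=; rewrite cons_head fcatr => ->.
  by [].
by rewrite cons_head fcatr.
Qed.

Lemma acl1E B c x : acl s (B `|` [set c]) x -> exists n (b : 'I_n -> N) k
    (P : relation L (1 + (1 + n))),
  [/\ definable P, bounded k P, forall i, B (b i) & P N s (x .: c .: b)].
Proof.
move=> /aclE[m [p [k [P [dP bP Bp Px]]]]].
have [n [b [n2 [c2 [r [Bb c2E pE]]]]]] := split_params Bp.
have [r' r'E] : exists r' : 'I_m -> 'I_(1 + n), p = (c .: b) \o r'.
  have /choice[r' r'E] : forall i, exists j, p i = (c .: b) j.
    move=> i; rewrite pE /=; case: (split_ordP (r i)) => j ->.
      by rewrite fcatl; exists (rshift 1 j); rewrite fcatr.
    by rewrite fcatr c2E; exists ord0; rewrite cons_head.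
  by exists r'; apply/funext.
exists n, b, k, (fun M t w => P M t (w \o ((ord0 : 'I_(1 + (1 + n))) .: (@rshift 1 (1 + n) \o r')))).
split=> //; first exact: definable_ren.
- move=> M t v h; apply: (bP M t (v \o r')); apply: atleastS h => y /=.
  by rewrite cons_ren.
- by rewrite cons_ren -r'E.
Qed.

(** There are finitely many conjugates of c over B, and finitely many x
    over each of them. *)
Lemma acl_trans1 B c x : acl s B c -> acl s (B `|` [set c]) x -> acl s B x.
Proof.
move=> /aclE[m [b' [k' [Q [dQ bQ Bb' Qc]]]]].
move=> /acl1E[n [b [k [P [dP bP Bb Px]]]]].
(* the variables of R, with its quantified c in front, are c, x, b and b' *)
pose rP : 'I_(1 + (1 + n)) -> 'I_(1 + (1 + (n + m))) :=
  @rshift 1 _ ord0 .: ord0 .: (fun j => rshift 1 (rshift 1 (lshift m j))).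
pose rQ : 'I_(1 + m) -> 'I_(1 + (1 + (n + m))) :=
  ord0 .: (fun j => rshift 1 (rshift 1 (rshift n j))).
pose R : relation L (1 + (n + m)) := fun M t w => exists c,
  P M t ((c .: w) \o rP) /\ Q M t ((c .: w) \o rQ).
have dR : definable R.
  apply: (definable_exists (P := fun M t u => P M t (u \o rP) /\ Q M t (u \o rQ))).
  by apply: definable_and; exact: definable_ren.
have RE y : R N s (y .: fcat b b') <-> exists c, P N s (y .: c .: b) /\ Q N s (c .: b').
  have e1 z : (z .: y .: fcat b b') \o rP = y .: z .: b.
    rewrite /rP !cons_comp cons_head fcatr cons_head; congr (_ .: (_ .: _)).
    by apply/funext => j /=; rewrite !fcatr fcatl.
  have e2 z : (z .: y .: fcat b b') \o rQ = z .: b'.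
    rewrite /rQ !cons_comp cons_head; congr (_ .: _).
    by apply/funext => j /=; rewrite !fcatr.
  by split=> -[z]; [rewrite e1 e2|rewrite -(e1 z) -(e2 z)]; exists z.
apply: (@acl_intro _ (fcat b b') R) => //.
- move=> i; case: (split_ordP i) => j ->; by rewrite (fcatl, fcatr).
- have fQ : finite_set [set z | Q N s (z .: b')] by apply/finite_atleast; exists k'; exact: bQ.
  have fP z : finite_set [set y | P N s (y .: z .: b)] by apply/finite_atleast; exists k; exact: bP.
  apply: (sub_finite_set _ (bigcup_finite fQ (fun z _ => fP z))) => y /RE[z [Pz Qz]].
  by exists z.
- by apply/RE; exists c.
Qed.

End Acl.

(** * Counting in finite sets *)

Section Counting.

Definition size_of (T : finType) (S : set T) := #|[set x | `[< S x >]]%SET|.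

Lemma in_asbool (T : finType) (S : set T) x : (x \in [set x | `[< S x >]]%SET) = `[< S x >].
Proof. exact: finset.in_set. Qed.

Lemma size_ofS (T : finType) (S S' : set T) : S `<=` S' -> (size_of S <= size_of S')%N.
Proof.
move=> SS'; apply/subset_leq_card/fintype.subsetP => x; rewrite !inE.
exact: SS'.
Qed.

Lemma size_of_sum (T : finType) (S : set T) : size_of S = (\sum_x `[< S x >])%N.
Proof.
by rewrite /size_of -sum1_card big_mkcond; apply: eq_bigr => x _; rewrite inE; case: asboolP.
Qed.

Lemma size_ofT (T : finType) : size_of [set: T] = #|T|.
Proof.
rewrite /size_of -cardsT; congr #|pred_of_set _|; apply/finset.setP => x.
by rewrite !inE asboolT.
Qed.

(** Counts the pairs (z, y) related by R, by rows and by columns. *)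
Lemma double_count (T T' : finType) (Z : set T) (D : set T') (R : T -> T' -> Prop) K a b :
  (forall z y, Z z -> R z y -> D y) ->
  (forall z, Z z -> (a <= K * size_of [set y | R z y])%N) ->
  (forall y, D y -> (size_of [set z | Z z /\ R z y] <= b)%N) ->
  (a * size_of Z <= K * (b * size_of D))%N.
Proof.
move=> hD ha hb.
apply: (@leq_trans (K * \sum_x \sum_y `[< Z x /\ R x y >])%N); last first.
  rewrite leq_mul2l exchange_big /= size_of_sum big_distrr /=.
  apply/orP; right; apply: leq_sum => y _; case: asboolP => Dy; rewrite ?muln1 ?muln0.
    by rewrite (leq_trans _ (hb y Dy)) // size_of_sum.
  rewrite leqn0 sum_nat_eq0; apply/forallP => z; apply/implyP => _.
  by rewrite eqb0; apply/asboolP => -[Zz /(hD _ _ Zz)].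
rewrite mulnC /size_of -sum1_card big_distrl big_distrr /= big_mkcond /=.
apply: leq_sum => z _; rewrite inE.
case: asboolP => // Zz; rewrite mul1n (leq_trans (ha z Zz)) // leq_mul2l size_of_sum.
apply/orP; right; apply: leq_sum => y _ /=.
by case: asboolP => //= zy; rewrite asboolT.
Qed.

End Counting.

(** * Tame families and exchange *)

Section Exchange.
Variables (I : Type) (U : set_system I) (FU : UltraFilter U) (M : I -> finType).
Variables (L : language) (s : forall i, structure L (M i)).

Definition big_sizes := forall k, \forall i \near U, (k <= #|M i|)%N.

(** The dichotomy of a one-dimensional asymptotic class, with its real constants
    merged into one natural number. *)
Definition tame := forall n (P : relation L (1 + n)), definable P ->
  exists k, \forall i \near U, forall v,
    (size_of [set x | P _ (s i) (x .: v)] <= k)%N \/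
    (#|M i| <= k * size_of [set x | P _ (s i) (x .: v)])%N.

Hypothesis big : big_sizes.
Hypothesis tm : tame.

Let ultra := ultra_str FU s.
Local Notation ultraproduct := (@ultraproduct I U FU (fun i => M i : Type)).

Lemma atleast_ultra n (P : relation L (1 + n)) k (v : 'I_n -> ultraproduct) : definable P ->
  atleast k [set x | P _ ultra (x .: v)] <->
  \forall i \near U, (k <= size_of [set x | P _ (s i) (x .: slice v i)])%N.
Proof.
move=> dP; rewrite (los_definable s (definable_atleast k dP) v).
by split; apply: filterS => i /atleast_card.
Qed.

Lemma infinite_large n (P : relation L (1 + n)) (v : 'I_n -> ultraproduct) : definable P ->
  infinite_set [set x | P _ ultra (x .: v)] ->
  exists k, \forall i \near U, (#|M i| <= k * size_of [set x | P _ (s i) (x .: slice v i)])%N.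
Proof.
move=> dP /infinite_atleast inf; have [k hk] := tm dP; exists k.
have /(atleast_ultra _ _ dP) hk1 := inf k.+1.
apply: filterS2 hk hk1 => i /(_ (slice v i))[le_k|//].
by move=> /leq_trans/(_ le_k); rewrite ltnn.
Qed.

(** Let P witness that x is algebraic over y, with fewer than k solutions x for
    each y.  If y is not algebraic over x, then x belongs to the B-definable set Z
    of the elements with many related y.  As x is not algebraic over B, the set Z
    is infinite.  By tameness Z and the fibres over Z have positive proportion, so
    there are at least c * #|M_i| ^ 2 related pairs, whereas there are at most
    k * #|M_i| of them. *)
Theorem exchange B x y : acl ultra (B `|` [set y]) x -> ~ acl ultra B x ->
  acl ultra (B `|` [set x]) y.
Proof.
move=> xBy xB; apply: contrapT => yBx.
have [n [b [k [P [dP bP Bb Px]]]]] := acl1E xBy.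
(* exchanges the first two variables *)
pose sw : 'I_(1 + (1 + n)) -> 'I_(1 + (1 + n)) :=
  @rshift 1 (1 + n) ord0 .: ord0 .: (fun j => @rshift 1 (1 + n) (@rshift 1 n j)).
have swE T u z (w : 'I_n -> T) : (u .: z .: w) \o sw = z .: u .: w.
  rewrite /sw !cons_comp cons_head fcatr cons_head; congr (_ .: (_ .: _)).
  by apply/funext => j /=; rewrite !fcatr.
pose Q : relation L (1 + (1 + n)) := fun M t w => P M t (w \o sw).
have dQ : definable Q by exact: definable_ren.
have [K hK] := tm dQ.
pose Z : relation L (1 + n) := fun M t w => atleast K.+1 [set u | Q M t (u .: w)].
have dZ : definable Z by exact: definable_atleast.
have Zx : Z _ ultra (x .: b).
  apply: infinite_atleast => fin; apply: yBx; apply: (acl_intro dQ _ fin).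
    move=> i; case: (split_ordP i) => j ->; rewrite ?fcatl ?fcatr; [by right|left; exact: Bb].
  by rewrite /Q swE.
have [K' hK'] : exists K', \forall i \near U,
    (#|M i| <= K' * size_of [set x | Z _ (s i) (x .: slice b i)])%N.
  by apply: infinite_large => // fin; apply: xB; exact: (acl_intro dZ Bb fin).
have [i [hi [hi' hi'']]] := filter_ex (filterI hK (filterI hK' (big (K' * (K * k)).+1))).
move: hi''; apply/negP; rewrite -leqNgt (leq_trans hi') // leq_mul2l.
have M0 : (0 < #|M i|)%N.
  by case: (str_inh (s i)) => z; apply/card_gt0P; exists z.
apply/orP; right; rewrite -(leq_pmul2r M0) mulnC -mulnA.
pose v := slice b i.
rewrite -[X in (_ <= _ * (_ * X))%N]size_ofT.
apply: (@double_count _ _ _ _ (fun z y => P _ (s i) (z .: y .: v))) => // [z /atleast_card hz|y' _].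
  have [|] := hi (z .: v); first by move=> /(leq_trans hz); rewrite ltnn.
  move=> /leq_trans; apply; rewrite leq_mul2l; apply/orP; right; apply: size_ofS => y' /=.
  by rewrite /Q swE.
apply: ltnW; rewrite ltnNge; apply/negP => /atleast_card h; apply: (bP _ (s i) (y' .: v)).
by apply: atleastS h => z [].
Qed.

End Exchange.

(** * Countable languages *)

Section Enumeration.
Variables (L : language) (cf : fsym L -> nat) (cr : rsym L -> nat).
Hypotheses (cf_inj : injective cf) (cr_inj : injective cr).

Fixpoint term_code n (t : term L n) : GenTree.tree nat :=
  match t with
  | Var i => GenTree.Leaf (i : nat)
  | App f u => GenTree.Node (cf f) [seq term_code (u j) | j <- enum 'I_(far f)]
  end.

(** The labels 0, 1 and 2 of inner nodes are taken by [Equ], [Imp] and [All], so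
    those of atoms start at 3. *)
Fixpoint formula_code n (phi : formula L n) : GenTree.tree nat :=
  match phi with
  | Fal _ => GenTree.Leaf 0%N
  | Equ _ t u => GenTree.Node 0 [:: term_code t; term_code u]
  | Rel _ r u => GenTree.Node (cr r).+3 [seq term_code (u j) | j <- enum 'I_(rar r)]
  | Imp _ p q => GenTree.Node 1 [:: formula_code p; formula_code q]
  | All _ p => GenTree.Node 2 [:: formula_code p]
  end.

Lemma map_enum_inj (A : Type) m (f g : 'I_m -> A) :
  [seq f j | j <- enum 'I_m] = [seq g j | j <- enum 'I_m] -> f =1 g.
Proof. by move=> /eq_in_map fg j; apply: fg; rewrite mem_enum. Qed.

Lemma term_code_inj n : injective (@term_code n).
Proof.
elim=> [i|f u IH] [j|g w] //=; first by case=> /val_inj ->.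
case=> /cf_inj fg; move: w; rewrite -fg => w /map_enum_inj uw.
by congr App; apply/funext => j; apply: IH; exact: uw.
Qed.

Lemma formula_code_inj n : injective (@formula_code n).
Proof.
elim=> {n} [n|n t u|n r u|n p IHp q IHq|n p IHp] psi.
- by case: psi.
- move: t u; case: n / psi => //= n t' u' t u [/term_code_inj -> /term_code_inj ->] //.
- move: u; case: n / psi => //= n r' u' u [/cr_inj rr].
  move: u'; rewrite -rr => u' /map_enum_inj uu.
  by congr Rel; apply/funext => j; apply: term_code_inj; exact: uu.
- move: p q IHp IHq; case: n / psi => //= n p' q' p q IHp IHq [/IHp -> /IHq ->] //.
- move: p IHp; case: n / psi => //= n p' p IHp [/IHp ->] //.
Qed.

Lemma formula_enum n : exists e : nat -> formula L n, forall phi, exists k, e k = phi.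
Proof.
have /choice[e eP] : forall k, exists phi : formula L n,
    forall psi, pickle (formula_code psi) = k -> psi = phi.
  move=> k; case: (pselect (exists phi : formula L n, pickle (formula_code phi) = k)) => [[phi pk]|nk].
    by exists phi => psi; rewrite -pk => /(pcan_inj pickleK)/formula_code_inj.
  by exists (Fal L n) => psi pk; case: nk; exists psi.
by exists e => phi; exists (pickle (formula_code phi)); rewrite -(eP _ phi erefl).
Qed.

End Enumeration.

(** * Countable saturation *)

Section Saturation.
Variables (I : Type) (U : set_system I) (FU : UltraFilter U).

(** Let x i witness the longest initial segment of conditions that is satisfiable
    at i, among those of length at most g i; this cut-off makes a longest one
    exist, and it tends to infinity. *)
Lemma countable_saturation (T : I -> Type) (g : I -> nat) (P : nat -> forall i, set (T i)) :
  (forall k, \forall i \near U, (k <= g i)%N) -> (forall i, inhabited (T i)) ->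
  (forall K, \forall i \near U, exists x, forall j, (j <= K)%N -> P j i x) ->
  exists x : forall i, T i, forall j, \forall i \near U, P j i (x i).
Proof.
move=> gU T0 fin.
have best i : exists x : T i, forall K, (K <= g i)%N ->
    (exists y, forall j, (j <= K)%N -> P j i y) -> forall j, (j <= K)%N -> P j i x.
  elim: (g i) => [|n [x IH]].
    case: (pselect (exists y, forall j, (j <= 0)%N -> P j i y)) => [[y yP]|ny].
      by exists y => K; rewrite leqn0 => /eqP ->.
    by case: (T0 i) => x; exists x => K; rewrite leqn0 => /eqP -> /ny.
  case: (pselect (exists y, forall j, (j <= n.+1)%N -> P j i y)) => [[y yP]|ny].
    by exists y => K Kn _ j jK; apply: yP; exact: leq_trans Kn.
  exists x => K; rewrite leq_eqVlt => /predU1P[-> /ny//|]; rewrite ltnS; exact: IH.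
exists (fun i => sval (cid (best i))) => j.
apply: filterS2 (fin j) (gU j) => i finj gj.
exact: (svalP (cid (best i)) j gj finj).
Qed.

End Saturation.

Lemma union_bound (T T' : finType) (D : set T') (R : T' -> set T) k :
  (forall y, D y -> (size_of (R y) <= k)%N) ->
  (size_of [set x | exists2 y, D y & R y x] <= k * size_of D)%N.
Proof.
move=> Rk; rewrite mulnC size_of_sum /size_of -sum1_card big_distrl /=.
apply: (@leq_trans (\sum_x \sum_(y in [set y | `[< D y >]]%SET) `[< R y x >])%N).
  apply: leq_sum => x _; case: asboolP => // -[y Dy Ry].
  by rewrite (bigD1 y) ?inE ?asboolT.
rewrite exchange_big /=; apply: leq_sum => y; rewrite inE => Dy; rewrite mul1n.
apply: leq_trans (Rk y _); last exact/asboolP.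
by rewrite size_of_sum.
Qed.

Lemma size_ffun_on (T : finType) m (A : {set T}) :
  (size_of [set h : {ffun 'I_m -> T} | forall t, h t \in A] <= #|A| ^ m)%N.
Proof.
rewrite -[X in (_ <= _ ^ X)%N]card_ord -card_ffun_on.
apply/subset_leq_card/fintype.subsetP => h; rewrite inE => /asboolP hA.
exact/ffun_onP.
Qed.

(** * Back and forth between H-free tuples *)

Section BackAndForth.
Variables (I : Type) (U : set_system I) (FU : UltraFilter U) (M : I -> finType).

(** Implied by a coarse dimension less than d, and inherited by the fibres over all
    points outside countably many thin sets, see [large_fibres_thin]. *)
Definition thin d (T : I -> finType) (X : forall i, set (T i)) :=
  forall k, \forall i \near U, (k * size_of (X i) <= #|M i| ^ d)%N.

Definition internal_set (H : forall i, {set M i}) : set (ultraproduct FU (fun i => M i : Type)) :=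
  [set x | \forall i \near U, urepr x i \in H i].

Definition subpolynomial (e : I -> nat) := forall k t, \forall i \near U, (k * e i ^ t <= #|M i|)%N.

Variables (L : language) (s : forall i, structure L (M i)).
Hypothesis big : big_sizes U M.
Hypothesis tm : tame U s.
Variable e : forall n, nat -> formula L n.
Hypothesis eP : forall n phi, exists k, e n k = phi.
Variable H : forall i, {set M i}.
Hypothesis Hsmall : subpolynomial (fun i => #|H i|).

Let ultra := ultra_str FU s.
Local Notation ultraproduct := (@ultraproduct I U FU (fun i => M i : Type)).
Local Notation HS := (internal_set H).

Definition same_type n (b b' : 'I_n -> ultraproduct) :=
  forall phi : formula L n, sat ultra phi b <-> sat ultra phi b'.

Lemma same_type_definable n (b b' : 'I_n -> ultraproduct) (P : relation L n) :
  same_type b b' -> definable P -> P _ ultra b <-> P _ ultra b'.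
Proof. by move=> bb' [phi phiP]; rewrite -!phiP. Qed.

Lemma same_type_sym n (b b' : 'I_n -> ultraproduct) : same_type b b' -> same_type b' b.
Proof. by move=> bb' phi; split=> /bb'. Qed.

Lemma same_type_ren n m (r : 'I_m -> 'I_n) (b b' : 'I_n -> ultraproduct) :
  same_type b b' -> same_type (b \o r) (b' \o r).
Proof.
move=> bb' phi; exact: (same_type_definable bb' (definable_ren r (definable_sat phi))).
Qed.

Lemma thinU d (T : I -> finType) (X Y : forall i, set (T i)) :
  thin d X -> thin d Y -> thin d (fun i => X i `|` Y i).
Proof.
move=> hX hY k; apply: filterS2 (hX (k * 2)%N) (hY (k * 2)%N) => i hXi hYi.
have : (size_of (X i `|` Y i) <= size_of (X i) + size_of (Y i))%N.
  apply: leq_trans (leq_card_setU _ _); apply/subset_leq_card/fintype.subsetP => x.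
  by rewrite !inE => -[] h; apply/orP; [left|right]; apply/asboolP.
move: hXi hYi; set a := size_of _; set b := size_of _; set c := size_of _; set d' := (_ ^ d)%N.
nia.
Qed.

Lemma thin_bigcup d (T : I -> finType) (X : nat -> forall i, set (T i)) :
  (forall j, thin d (X j)) ->
  forall K, thin d (fun i => [set x | exists2 j, (j <= K)%N & X j i x]).
Proof.
move=> hX; elim=> [|K IH] k.
  apply: filterS (hX 0%N k) => i; apply: leq_trans; rewrite leq_mul2l; apply/orP; right.
  by apply: size_ofS => x [j]; rewrite leqn0 => /eqP ->.
apply: filterS (thinU IH (hX K.+1) k) => i; apply: leq_trans; rewrite leq_mul2l; apply/orP; right.
apply: size_ofS => x [j]; rewrite leq_eqVlt => /predU1P[->|]; [by right|].
by rewrite ltnS => jK Xj; left; exists j.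
Qed.

Lemma thin_avoid d (T : I -> finType) (Y Z : forall i, set (T i)) k :
  (\forall i \near U, (#|M i| ^ d <= k * size_of (Y i))%N) -> thin d Z ->
  \forall i \near U, exists2 x, Y i x & ~ Z i x.
Proof.
move=> hY hZ; apply: filterS3 hY (hZ k.+1) (big 1) => i hYi hZi M0.
apply: contrapT => nx.
have YZ : Y i `<=` Z i.
  by move=> x Yx; apply: contrapT => nZx; apply: nx; exists x.
have := size_ofS YZ; have : (0 < #|M i| ^ d)%N by rewrite expn_gt0 M0.
move: hYi hZi; set a := size_of _; set b := size_of _; set c := (_ ^ d)%N.
nia.
Qed.

(** The type of c, transported to b', is countable, and each of its formulas
    defines a set of positive proportion; finitely many thin sets do not cover
    it.  So the type and the complements of the Z j are finitely satisfiable. *)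
Lemma generic_realization n (b b' : 'I_n -> ultraproduct) c (Z : nat -> forall i, set (M i)) :
  same_type b b' -> ~ acl ultra (range b) c -> (forall j, thin 1 (Z j)) ->
  exists c', same_type (c .: b) (c' .: b') /\ forall j, \forall i \near U, ~ Z j i (urepr c' i).
Proof.
move=> bb' bc hZ.
pose P j i x := (sat ultra (e _ j) (c .: b) -> sat (s i) (e _ j) (x .: slice b' i)) /\ ~ Z j i x.
have [|i|K|x xP] := @countable_saturation _ _ _ (fun i => M i : Type) (fun i => #|M i|) P.
- exact: big.
- exact: str_inh (s i).
- have [Q [dQ Qc QP]] : exists Q : relation L (1 + n), [/\ definable Q, Q _ ultra (c .: b) &
      forall N (t : structure L N) w, Q N t w -> forall j, (j <= K)%N ->
        sat ultra (e _ j) (c .: b) -> sat t (e _ j) w].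
    elim: K => [|K [Q [dQ Qc QP]]].
      exists (fun N t w => sat ultra (e (1 + n) 0%N) (c .: b) -> sat t (e _ 0%N) w).
      split=> // [|N t w h j]; last by rewrite leqn0 => /eqP ->.
      case: (pselect (sat ultra (e (1 + n) 0%N) (c .: b))) => h.
        by apply: definable_iff (definable_sat (e (1 + n) 0%N)) => N t w; split=> // /(_ h).
      by exists (Imp (Fal L _) (Fal L _)) => N t w; split=> // _ hh; case: h.
    exists (fun N t w => Q N t w /\ (sat ultra (e (1 + n) K.+1) (c .: b) -> sat t (e _ K.+1) w)).
    split=> //; last first.
      move=> N t w [Qw h] j; rewrite leq_eqVlt => /predU1P[->//|]; rewrite ltnS; exact: QP.
    apply: definable_and => //.
    case: (pselect (sat ultra (e (1 + n) K.+1) (c .: b))) => h.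
      by apply: definable_iff (definable_sat (e (1 + n) K.+1)) => N t w; split=> // /(_ h).
    by exists (Imp (Fal L _) (Fal L _)) => N t w; split=> // _ hh; case: h.
  have inf : infinite_set [set x | Q _ ultra (x .: b')].
    move=> /finite_atleast[k]; apply.
    apply/(same_type_definable bb' (definable_atleast k dQ)).
    apply: infinite_atleast => fin; by apply: bc; apply: (acl_intro dQ _ fin).
  have [k hk] := infinite_large tm dQ inf.
  have := @thin_avoid 1 (fun i => M i) (fun i => [set x | Q _ (s i) (x .: slice b' i)])
     (fun i => [set x | exists2 j, (j <= K)%N & Z j i x]) k hk (thin_bigcup hZ K).
  apply: filterS => i [x Qx nZ]; exists x => j jK; split; first exact: QP Qx _ jK.
  by move=> Zx; apply: nZ; exists j.

exists (upi FU x); split=> [phi|j]; last first.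
  by apply: filterS2 (xP j) (urepr_upi FU x) => i [_ nZ] ->.
suff imp psi : sat ultra psi (c .: b) -> sat ultra psi (upi FU x .: b').
  split; first exact: imp.
  by move=> h; apply: contrapT => nh; have := imp (Neg phi) nh; apply.
have [j <-] := eP psi => h; apply/los.
apply: filterS2 (xP j) (urepr_upi FU x) => i [/(_ h) + _] xE.
by rewrite slice_cons xE.
Qed.

(** The elements whose algebraicity over v and m elements of H is witnessed by
    phi, with fewer than k conjugates. *)
Definition acl_witness n (v : 'I_n -> ultraproduct) m k (phi : formula L (1 + (m + n))) i : set (M i) :=
  [set x | exists2 h : {ffun 'I_m -> M i}, (forall t, h t \in H i) &
     sat (s i) phi (x .: fcat h (slice v i)) /\
     ~ atleast k [set y | sat (s i) phi (y .: fcat h (slice v i))]].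

(** There are #|H_i| ^ m choices of h, which is negligible, and fewer than k
    elements for each of them. *)
Lemma acl_witness_thin n (v : 'I_n -> ultraproduct) m k (phi : formula L (1 + (m + n))) :
  thin 1 (acl_witness v k phi).
Proof.
move=> l; apply: filterS (Hsmall (l * k) m) => i; rewrite expn1; apply: leq_trans.
rewrite -mulnA leq_mul2l; apply/orP; right.
pose D : set {ffun 'I_m -> M i} := [set h | forall t, h t \in H i].
pose R (h : {ffun 'I_m -> M i}) := [set x | sat (s i) phi (x .: fcat h (slice v i)) /\
     ~ atleast k [set y | sat (s i) phi (y .: fcat h (slice v i))]].
have Rk h : D h -> (size_of (R h) <= k)%N.
  move=> _; rewrite leqNgt; apply/negP => /atleast_card[x [_ nk] hk]; apply: nk.
  by apply: atleastS hk => y [[]].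
apply: leq_trans (union_bound Rk) _; rewrite leq_mul2l; apply/orP; right.
exact: size_ffun_on.
Qed.

Lemma acl_witnessP n (v : 'I_n -> ultraproduct) x : acl ultra (range v `|` HS) x ->
  exists m k (phi : formula L (1 + (m + n))),
    \forall i \near U, acl_witness v k phi (urepr x i).
Proof.
move=> xvH; have [q [p [k [P [dP bP pvH Px]]]]] := aclE xvH.
have [n1 [b [m [h [r [bv hH pE]]]]]] := split_params pvH.
have /choice[j jE] : forall t, exists j, b t = v j by move=> t; case: (bv t) => j _ <-; exists j.
have [r' r'E] : exists r' : 'I_q -> 'I_(m + n), p = fcat h v \o r'.
  have /choice[r' r'E] : forall t, exists t', p t = fcat h v t'.
    move=> t; rewrite pE /=; case: (split_ordP (r t)) => t' ->.
      by rewrite fcatl jE; exists (rshift m (j t')); rewrite fcatr.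
    by rewrite fcatr; exists (lshift n t'); rewrite fcatl.
  by exists r'; apply/funext.
have [phi phiP] : definable (fun N (t : structure L N) w =>
    P N t (w \o ((ord0 : 'I_(1 + (m + n))) .: (@rshift 1 _ \o r')))) by exact: definable_ren.
have phiE N t x' (w : 'I_(m + n) -> N) : sat t phi (x' .: w) <-> P N t (x' .: (w \o r')).
  by rewrite phiP cons_ren.
exists m, k, phi.
have : sat ultra phi (x .: fcat h v) by rewrite phiE -r'E.
move=> /los; apply: filterS2 (near_all_ord FU hH) => i hi hx.
exists [ffun t => urepr (h t) i]; first by move=> t; rewrite ffunE; exact: hi.
have -> : fcat [ffun t => urepr (h t) i] (slice v i) = slice (fcat h v) i.
  by rewrite slice_fcat; congr fcat; apply/funext => t; rewrite ffunE.
split; first by move: hx; rewrite slice_cons.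
move=> at_k; apply: (bP _ (s i) (slice (fcat h v) i \o r')); apply: atleastS at_k => y.
by move/phiE.
Qed.

Lemma generic_extension n (b b' : 'I_n -> ultraproduct) c (Z : nat -> forall i, set (M i)) :
  same_type b b' -> ~ acl ultra (range b) c -> (forall j, thin 1 (Z j)) ->
  exists c', [/\ same_type (c .: b) (c' .: b'), ~ acl ultra (range b' `|` HS) c'
    & forall j, \forall i \near U, ~ Z j i (urepr c' i)].
Proof.
move=> bb' bc Zn.
(* one sequence for the Z l and for the sets of algebraic elements *)
pose Z' j : forall i, set (M i) := match unpickle j : option (nat + nat * nat * nat) with
  | Some (inl l) => Z l
  | Some (inr (m, k, q)) => acl_witness b' k (e (1 + (m + n)) q)
  | None => fun=> set0 end.
have [|c' [cc' c'Z]] := generic_realization (Z := Z') bb' bc.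
  move=> j; rewrite /Z'; case: unpickle => [[l|[[m k] q]]|] //; first exact: acl_witness_thin.
  by move=> k; near=> i; rewrite /size_of (eq_card0 (A := _)) ?muln0 // => x; rewrite inE asboolF.
exists c'; split=> // [|j].
  move=> /acl_witnessP[m [k [phi hphi]]]; have [q qE] := eP phi.
  have := c'Z (pickle (inr (m, k, q) : nat + nat * nat * nat)); rewrite /Z' pickleK qE.
  by move=> nh; have [i []] := filter_ex (filterI hphi nh).
by have := c'Z (pickle (inl j : nat + nat * nat * nat)); rewrite /Z' pickleK.
Unshelve. all: by end_near. Qed.

Implicit Types (B : set ultraproduct).

(** B is independent from H over its elements in H: the other elements of H stay
    independent over B.  The weaker condition that acl(B) meets H inside B would
    not survive the addition of elements of H. *)
Definition H_free B := forall h, HS h -> acl ultra (B `|` (HS `\ h)) h -> B h.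

(** If c makes h algebraic over B and the rest of H, then by exchange c is
    algebraic over B and H. *)
Lemma H_free_generic B c : H_free B -> ~ acl ultra (B `|` HS) c -> H_free (B `|` [set c]).
Proof.
move=> Bf cB h hH; rewrite setUAC => hc; left; apply: Bf => //; apply: contrapT => nh.
apply: cB; apply: acl_sub (exchange big tm hc nh) => x [[Bx|[Hx _]]|->]; by [left|right].
Qed.

Lemma H_free_acl B c : H_free B -> acl ultra B c -> H_free (B `|` [set c]).
Proof.
move=> Bf cB h hH; rewrite setUAC => hc; left; apply: Bf => //.
apply: acl_trans1 hc; apply: acl_sub cB => x; by left.
Qed.

Lemma H_free_H B c : H_free B -> HS c -> H_free (B `|` [set c]).
Proof.
move=> Bf cH h hH hc; case: (pselect (h = c)) => [->|hnc]; first by right.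
left; apply: Bf => //; apply: acl_sub hc => x [[Bx|->]|Hx]; [by left|right|by right].
by split=> // ch; apply: hnc.
Qed.

Lemma acl_rangeE n (b : 'I_n -> ultraproduct) x : acl ultra (range b) x ->
  exists k (P : relation L (1 + n)),
  [/\ definable P, bounded k P & P _ ultra (x .: b)].
Proof.
move=> xb; have [q [p [k [P [dP bP pb Px]]]]] := aclE xb.
have /choice[r rE] : forall t, exists j, p t = b j by move=> t; case: (pb t) => j _ <-; exists j.
exists k, (fun N t w => P N t (w \o ((ord0 : 'I_(1 + n)) .: (@rshift 1 _ \o r)))).
split=> //; first exact: definable_ren.
- move=> N t v h; apply: (bP N t (v \o r)); apply: atleastS h => y /=.
  by rewrite cons_ren.
- by rewrite cons_ren (_ : b \o r = p) //; apply/funext => t /=; rewrite rE.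
Qed.

Lemma same_type_acl n (b b' : 'I_n -> ultraproduct) c c' :
  same_type (c .: b) (c' .: b') -> acl ultra (range b) c -> acl ultra (range b') c'.
Proof.
move=> cc' /acl_rangeE[k [P [dP bP Pc]]].
apply: (acl_intro (b := b') dP) => //; last exact/(same_type_definable cc' dP).
by apply/finite_atleast; exists k; exact: bP.
Qed.

Lemma same_type_eq n (b b' : 'I_n -> ultraproduct) i j :
  same_type b b' -> b i = b j -> b' i = b' j.
Proof. by move=> bb' ij; apply/(same_type_definable bb' (definable_eq L i j)). Qed.

(** The positions of the back-and-forth game. *)
Definition alike n (b b' : 'I_n -> ultraproduct) :=
  [/\ same_type b b', forall i, HS (b i) <-> HS (b' i), H_free (range b) & H_free (range b')].

Lemma alike_sym n (b b' : 'I_n -> ultraproduct) : alike b b' -> alike b' b.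
Proof. by case=> ? hi ? ?; split=> // [|i]; [exact: same_type_sym|rewrite hi]. Qed.

Lemma range_cons n (b : 'I_n -> ultraproduct) c : range (c .: b) = range b `|` [set c].
Proof.
apply/seteqP; split=> x.
  by move=> [i _ <-]; case: (split_ordP i) => j ->; rewrite ?fcatl ?fcatr; [right|left; exists j].
case=> [[j _ <-]|->]; first by exists (rshift 1 j); rewrite ?fcatr.
by exists ord0 => //; rewrite cons_head.
Qed.

Lemma alike_cons n (b b' : 'I_n -> ultraproduct) c c' : alike b b' ->
  same_type (c .: b) (c' .: b') -> (HS c <-> HS c') ->
  H_free (range b `|` [set c]) -> H_free (range b' `|` [set c']) ->
  alike (c .: b) (c' .: b').
Proof.
move=> [bb' bH _ _] cc' cH fc fc'; split=> //; rewrite ?range_cons // => i.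
by case: (split_ordP i) => j ->; rewrite ?fcatl ?fcatr.
Qed.

(** A formula true of c over b with the fewest solutions isolates the type of c
    over b: adding a formula of the type cannot exclude a solution. *)
Lemma algebraic_realization n (b b' : 'I_n -> ultraproduct) c :
  same_type b b' -> acl ultra (range b) c -> exists c', same_type (c .: b) (c' .: b').
Proof.
move=> bb' /acl_rangeE[k0 [P0 [dP0 bP0 P0c]]].
pose iso k := exists P : relation L (1 + n),
  [/\ definable P, P _ ultra (c .: b) & ~ atleast k [set x | P _ ultra (x .: b)]].
have exk : exists k, `[< iso k >].
  by exists k0; apply/asboolP; exists P0; split=> //; exact: bP0.
case: (ex_minnP exk) => k /asboolP[P [dP Pc nk]] mink.
have [c' Pc'] : exists c', P _ ultra (c' .: b').
  apply/(same_type_definable bb' (definable_exists dP)); by exists c.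
exists c'; suff imp psi : sat ultra psi (c .: b) -> sat ultra psi (c' .: b').
  move=> phi; split; first exact: imp.
  by move=> h; apply: contrapT => nh; have := imp (Neg phi) nh; apply.
move=> psic.
have dQ : definable (fun N (t : structure L N) w => P N t w -> sat t psi w).
  by apply: definable_imp => //; exact: definable_sat.
suff : forall x, P _ ultra (x .: b') -> sat ultra psi (x .: b') by apply.
apply/(same_type_definable bb' (definable_forall dQ)) => x Px.
apply: contrapT => npsi.
(* excluding x would leave fewer than k solutions, out of fewer than k + 1 *)
case: k nk mink => [|k] nk mink; first by apply: nk.
suff /mink : `[< iso k >] by rewrite ltnn.
apply/asboolP; exists (fun N (t : structure L N) w => P N t w /\ sat t psi w); split=> //.
  by apply: definable_and => //; exact: definable_sat.
move=> h; apply: nk; exists x => //; apply: atleastS h => y [Py psiy]; split=> // yx.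
by apply: npsi; rewrite -yx.
Qed.

(** An element of H that is algebraic over the H-free tuple b is an entry of b,
    so its answer is the corresponding entry of b'. *)
Lemma alike_acl n (b b' : 'I_n -> ultraproduct) c : alike b b' ->
  acl ultra (range b) c -> exists c', alike (c .: b) (c' .: b').
Proof.
move=> sb cb; have [bb' bH fb fb'] := sb.
have [c' cc'] := algebraic_realization bb' cb; exists c'.
have c'b' := same_type_acl cc' cb.
have HSimp (v v' : 'I_n -> ultraproduct) d d' : same_type (d .: v) (d' .: v') ->
    acl ultra (range v) d -> H_free (range v) -> (forall i, HS (v i) -> HS (v' i)) -> HS d -> HS d'.
  move=> dd' dv fv vH dH.
  have [j _ jd] : range v d by apply: fv => //; apply: acl_sub dv => x; left.
  have : (d .: v) ord0 = (d .: v) (rshift 1 j) by rewrite cons_head fcatr.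
  move=> /(same_type_eq dd'); rewrite cons_head fcatr => ->; apply: vH.
  by rewrite jd.
apply: alike_cons => //; try exact: H_free_acl.
split.
  by apply: (HSimp b b') => // i; rewrite bH.
by apply: (HSimp b' b) => // [|i]; [exact: same_type_sym|rewrite bH].
Qed.

(** The density of H, for the types over finite tuples. *)
Hypothesis realize_in_H : forall n (b b' : 'I_n -> ultraproduct) c,
  same_type b b' -> ~ acl ultra (range b) c ->
  exists2 c', HS c' & same_type (c .: b) (c' .: b').

Lemma alike_H n (b b' : 'I_n -> ultraproduct) c : alike b b' ->
  HS c -> exists c', alike (c .: b) (c' .: b').
Proof.
move=> sb cH; case: (pselect (acl ultra (range b) c)) => cb; first exact: alike_acl.
have [bb' bH fb fb'] := sb.
have [c' c'H cc'] := realize_in_H bb' cb.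
by exists c'; apply: alike_cons => //; exact: H_free_H.
Qed.

Lemma alike_fcat_H n (b b' : 'I_n -> ultraproduct) m (h : 'I_m -> ultraproduct) :
  alike b b' -> (forall i, HS (h i)) -> exists h', alike (fcat h b) (fcat h' b').
Proof.
elim: m h => [|m IH] h sb hH; first by exists h; rewrite !fcat_nil.
have [|h' h'P] := IH (h \o @rshift 1 m) sb; first by move=> i; exact: hH.
have [c' c'P] := alike_H h'P (hH ord0).
by exists (c' .: h'); rewrite (cons_eta h) -!cons_fcat.
Qed.

Lemma alike_generic n (b b' : 'I_n -> ultraproduct) c (Z : nat -> forall i, set (M i)) :
  alike b b' -> ~ acl ultra (range b `|` HS) c -> (forall j, thin 1 (Z j)) ->
  exists c', alike (c .: b) (c' .: b') /\ forall j, \forall i \near U, ~ Z j i (urepr c' i).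
Proof.
move=> sb cb Zt; have [bb' bH fb fb'] := sb.
have cb0 : ~ acl ultra (range b) c by move=> h; apply: cb; apply: acl_sub h => x; left.
have [c' [cc' c'b' c'Z]] := generic_extension bb' cb0 Zt.
exists c'; split=> //; apply: alike_cons => //; try exact: H_free_generic.
by split=> h; [case: cb|case: c'b']; apply: acl_incl; right.
Qed.

Lemma thin0 d (T : I -> finType) : thin d (fun i : I => set0 : set (T i)).
Proof.
move=> k; apply: nearW => i.
by rewrite /size_of (eq_card0 (A := _)) ?muln0 // => x; rewrite inE asboolF.
Qed.

(** If c is algebraic over b and H, finitely many elements of H are added first;
    then c is algebraic over the extended tuple.  Otherwise c is generic. *)
Lemma alike_forth n (b b' : 'I_n -> ultraproduct) c : alike b b' ->
  exists m (b2 b2' : 'I_m -> ultraproduct) (r : 'I_n -> 'I_m) j,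
    [/\ alike b2 b2', b = b2 \o r, b' = b2' \o r & b2 j = c].
Proof.
move=> sb.
have fin m (h h' : 'I_m -> ultraproduct) c' : alike (c .: fcat h b) (c' .: fcat h' b') ->
    exists m (b2 b2' : 'I_m -> ultraproduct) (r : 'I_n -> 'I_m) j,
    [/\ alike b2 b2', b = b2 \o r, b' = b2' \o r & b2 j = c].
  move=> sc; exists (1 + (m + n))%N, (c .: fcat h b), (c' .: fcat h' b'),
    (fun i => rshift 1 (rshift m i)), ord0.
  by split=> //; rewrite ?cons_head //; apply/funext => i /=; rewrite !fcatr.
case: (pselect (acl ultra (range b `|` HS) c)) => cb; last first.
  have [c' [sc _]] := alike_generic sb cb (fun j => @thin0 1 (fun i => M i)).
  by apply: (fin 0%N (fun _ => c) (fun _ => c) c'); rewrite !fcat_nil.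
have [q [p [k [P [dP bP pb Pc]]]]] := aclE cb.
have [n1 [v [m [h [r [vb hH pE]]]]]] := split_params pb.
have [h' hh'] := alike_fcat_H sb hH.
have [|c' sc] := alike_acl (c := c) hh'; last exact: fin sc.
apply: (acl_intro dP (b := p)) => //; last by apply/finite_atleast; exists k; exact: bP.
move=> i; rewrite pE /=; case: (split_ordP (r i)) => j ->.
  by rewrite fcatl; case: (vb j) => t _ <-; exists (rshift m t); rewrite ?fcatr.
by rewrite fcatr; exists (lshift n j); rewrite ?fcatl.
Qed.

Lemma alike_forth_tuple k (a : 'I_k -> ultraproduct) n (b b' : 'I_n -> ultraproduct) :
  alike b b' ->
  exists m (b2 b2' : 'I_m -> ultraproduct) (r : 'I_n -> 'I_m) (t : 'I_k -> 'I_m),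
    [/\ alike b2 b2', b = b2 \o r, b' = b2' \o r & a = b2 \o t].
Proof.
elim: k a n b b' => [|k IH] a n b b' bb'.
  exists n, b, b', id, (@no_vars 'I_n); split=> //.
  by apply/funext; case.
have [m [b2 [b2' [r [j [bb2 bE b'E jE]]]]]] := alike_forth (a ord0) bb'.
have [m' [b3 [b3' [r' [t [bb3 b2E b2'E tE]]]]]] := IH (a \o @rshift 1 k) _ _ _ bb2.
exists m', b3, b3', (r' \o r), (r' j .: t); split=> //.
- by rewrite bE b2E.
- by rewrite b'E b2'E.
- by rewrite (cons_eta a) cons_comp -tE -jE b2E.
Qed.

(** Entries are added one by one; before an entry that is algebraic over H and
    the preceding ones, the elements of H on which it depends are added. *)
Lemma H_free_extend n (b0 : 'I_n -> ultraproduct) : H_free set0 ->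
  exists m (b : 'I_m -> ultraproduct) (r : 'I_n -> 'I_m),
    [/\ H_free (range b), b0 = b \o r & range b `<=` range b0 `|` HS].
Proof.
move=> f0; elim: n b0 => [|n IH] b0.
  exists 0%N, b0, id; split=> //.
  by rewrite (_ : range b0 = set0) //; apply/seteqP; split=> // x [[]].
have [m [b [r [fb bE bH]]]] := IH (b0 \o @rshift 1 n).
have b0E : range b0 = range (b0 \o @rshift 1 n) `|` [set b0 ord0].
  by rewrite -range_cons -cons_eta.
have fin k (h : 'I_k -> ultraproduct) : (forall i, HS (h i)) -> H_free (range (b0 ord0 .: fcat h b)) ->
    exists m (b : 'I_m -> ultraproduct) (r : 'I_n.+1 -> 'I_m),
    [/\ H_free (range b), b0 = b \o r & range b `<=` range b0 `|` HS].
  move=> hH fc; exists (1 + (k + m))%N, (b0 ord0 .: fcat h b),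
    ((ord0 : 'I_(1 + (k + m))) .: (fun i => rshift 1 (rshift k (r i)))); split=> //.
    rewrite cons_comp cons_head {1}(cons_eta b0) bE; congr (_ .: _); apply/funext => i /=.
    by rewrite !fcatr.
  rewrite range_cons => x [[j _ <-]|->]; last by left; exists ord0.
  case: (split_ordP j) => t ->; rewrite ?fcatl ?fcatr; first by right.
  have [[u _ <-]|Hx] : (range (b0 \o @rshift 1 n) `|` HS) (b t) by apply: bH; exists t.
    by left; exists (rshift 1 u).
  by right.
case: (pselect (acl ultra (range b `|` HS) (b0 ord0))) => cb; last first.
  (* a dummy family of length 0: no element of H has to be added *)
  apply: (fin 0%N (fun _ => b0 ord0)) => [[]//|]; rewrite fcat_nil range_cons.
  exact: H_free_generic.
have [q [p [k [P [dP bP pb Pc]]]]] := aclE cb.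
have [n1 [v [l [h [t [vb hH pE]]]]]] := split_params pb.
apply: (fin l h) => //; rewrite range_cons; apply: H_free_acl.
  elim: l h {t pE} hH => [|l IHl] h hH; first by rewrite fcat_nil.
  rewrite (cons_eta h) -cons_fcat range_cons; apply: H_free_H; last exact: hH.
  by apply: IHl => i; exact: hH.
apply: (acl_intro dP (b := p)) => //; last by apply/finite_atleast; exists k; exact: bP.
move=> i; rewrite pE /=; case: (split_ordP (t i)) => j ->.
  by rewrite fcatl; case: (vb j) => u _ <-; exists (rshift l u); rewrite ?fcatr.
by rewrite fcatr; exists (lshift m j); rewrite ?fcatl.
Qed.

Definition indep_tuple d (a : 'I_d -> ultraproduct) (B : set ultraproduct) :=
  forall j : 'I_d, ~ acl ultra (B `|` [set a l | l in [set l : 'I_d | (j < l)%N]]) (a j).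

Definition fslice d (a : 'I_d -> ultraproduct) i : {ffun 'I_d -> M i} :=
  [ffun j => slice a i j].

Definition fcons d (T : finType) (x : T) (w : {ffun 'I_d -> T}) : {ffun 'I_(1 + d) -> T} :=
  [ffun j => (x .: w) j].

Lemma fcons_inj d (T : finType) (x y : T) (w w' : {ffun 'I_d -> T}) :
  fcons x w = fcons y w' -> x = y /\ w = w'.
Proof.
move=> /ffunP h; split; first by have := h ord0; rewrite !ffunE !cons_head.
by apply/ffunP => j; have := h (rshift 1 j); rewrite !ffunE !fcatr.
Qed.

(** Fubini: each of these w contributes more than #|M_i| / k elements to X. *)
Lemma large_fibres_thin d (X : forall i, set {ffun 'I_(1 + d) -> M i}) k :
  thin (1 + d) X ->
  thin d (fun i => [set w | (#|M i| < k * size_of [set x | X i (fcons x w)])%N]).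
Proof.
move=> Xt l; apply: filterS2 (Xt (l * k)%N) (big 1) => i hX M0.
set Z := (X in size_of X); rewrite -(leq_pmul2r M0) -expnSr.
apply: leq_trans hX; rewrite -2!mulnA leq_mul2l; apply/orP; right.
have -> : size_of (X i) = (1 * size_of (X i))%N by rewrite mul1n.
rewrite [leqLHS]mulnC.
apply: (@double_count _ _ _ _ (fun w f => X i f /\ exists x, f = fcons x w)).
- by move=> w f _ [].
- move=> w /ltnW /leq_trans; apply; rewrite leq_mul2l; apply/orP; right.
  rewrite /size_of -(card_imset (f := fun x => fcons x w)); last by move=> x y /fcons_inj[].
  apply/subset_leq_card/fintype.subsetP => f /imsetP[x]; rewrite !in_asbool => /asboolP Xx ->.
  by apply/asboolP; split=> //; exists x.
- move=> f Xf; rewrite leqNgt; apply/negP => /(atleast_card 2)[w [_ [_ [x fx]]]].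
  case=> w' [[_ [_ [x' fx']]] ww'] _; apply: ww'.
  by have [] : x = x' /\ w = w' by apply: fcons_inj; rewrite -fx.
Qed.

(** Induction on the length, for countably many thin sets at once: to avoid one
    of them, the tail of the tuple must avoid, for each k, the set over which its
    fibres are larger than #|M_i| / k. *)
Lemma generic_tuple d : forall n (b b' : 'I_n -> ultraproduct) (a : 'I_d -> ultraproduct)
    (X : nat -> forall i, set {ffun 'I_d -> M i}),
  alike b b' -> indep_tuple a (range b `|` HS) -> (forall j, thin d (X j)) ->
  exists a' : 'I_d -> ultraproduct, alike (fcat a b) (fcat a' b') /\
    forall j, \forall i \near U, ~ X j i (fslice a' i).
Proof.
elim: d => [|d IH] n b b' a X sb ai Xt.
  exists a; rewrite !fcat_nil; split=> // j.
  apply: filterS (Xt j 2) => i; rewrite expn0 => hX Xi.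
  suff : (1 <= size_of (X j i))%N by lia.
  by apply/card_gt0P; exists (fslice a i); rewrite inE; exact/asboolP.
pose at_ := a \o @rshift 1 d.
pose Y q i : set {ffun 'I_d -> M i} := match unpickle q : option (nat * nat) with
  | Some (j, k) => [set w | (#|M i| < k * size_of [set x | X j i (fcons x w)])%N]
  | None => set0 end.
have [||a' [sa' a'Y]] := IH n b b' at_ Y sb.
- move=> j; have := ai (rshift 1 j); apply: contra_not; apply: acl_sub => x [?|[l /= jl <-]].
    by left.
  by right; exists (rshift 1 l).
- move=> q; rewrite /Y; case: unpickle => [[j k]|]; first exact: large_fibres_thin.
  exact: thin0.
pose Z j i : set (M i) := [set x | X j i (fcons x (fslice a' i))].
have [||c' [sc' c'Z]] := alike_generic sa' (c := a ord0) (Z := Z).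
- apply: contra_not (ai ord0); apply: acl_sub => x [[j _ <-]|]; last by left; right.
  case: (split_ordP j) => t ->; rewrite ?fcatl ?fcatr; last by left; left; exists t.
  by right; exists (rshift 1 t).
- move=> j k; have := a'Y (pickle (j, k)); rewrite /Y pickleK.
  by apply: filterS => i; rewrite expn1 /= => /negP; rewrite -leqNgt.
exists (c' .: a'); split; first by rewrite {1}(cons_eta a) -!cons_fcat.
move=> j; apply: filterS (c'Z j) => i; rewrite /Z /=; apply: contra_not.
rewrite (_ : fcons _ _ = fslice (c' .: a') i) //; apply/ffunP => t; rewrite !ffunE slice_cons.
by congr (fcat _ _ _); apply/funext => u; rewrite ffunE.
Qed.

End BackAndForth.

(** * Formulas with H *)

Section Preservation.
Variables (I : Type) (U : set_system I) (FU : UltraFilter U) (M : I -> finType).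
Variables (L : language) (s : forall i, structure L (M i)).
Variables (F : set (fsym L)) (G : set (rsym L)) (H : forall i, {set M i}).
Let s0 i := reduct F G (s i).
Hypothesis big : big_sizes U M.
Hypothesis tm : tame U s0.
Variable e : forall n, nat -> formula (sublanguage F G) n.
Hypothesis eP : forall n phi, exists k, e n k = phi.
Hypothesis Hsmall : subpolynomial U M (fun i => #|H i|).
Let ultra := ultra_str FU s0.
Local Notation ultraproduct := (@ultraproduct I U FU (fun i => M i : Type)).
Local Notation HS := (@internal_set I U FU M H).
Hypothesis realize_in_H : forall n (b b' : 'I_n -> ultraproduct) c,
  same_type s0 b b' -> ~ acl ultra (range b) c ->
  exists2 c', HS c' & same_type s0 (c .: b) (c' .: b').

Lemma reduct_term n (t : term (LH L) n) : term_fsyms t `<=` F ->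
  exists t0 : term (sublanguage F G) n, forall v, eval (upair FU s H) v t = eval ultra v t0.
Proof.
move=> tF; have [|t0 t0E] := @term_transfer (LH L) (sublanguage F G)
  (fun N s1 s2 => forall f : Defs.fsym (sublanguage F G), fint s2 f = fint s1 (sval f)) n t.
  move=> f /tF Ff m u; exists (@App (sublanguage F G) m (exist _ f Ff) u) => N s1 s2 v h /=.
  by rewrite h.
by exists t0 => v; rewrite -(t0E _ (upair FU s H) ultra).
Qed.

(** For an atom saying that a term t lies in H: its value at b is algebraic over
    b, hence an entry b_j of the H-free tuple b, and the equation t = b_j is an
    L-formula, preserved together with membership of entries in H. *)
Lemma alike_sat m (phi : formula (LH L) m) : formula_fsyms phi `<=` F ->
  (forall r, formula_rsyms phi (Some r) -> G r) ->
  forall n (b b' : 'I_n -> ultraproduct) (r : 'I_m -> 'I_n), alike s0 H b b' ->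
  sat (upair FU s H) phi (b \o r) <-> sat (upair FU s H) phi (b' \o r).
Proof.
move=> pF pG; suff imp n (b b' : 'I_n -> ultraproduct) (r : 'I_m -> 'I_n) :
    alike s0 H b b' -> sat (upair FU s H) phi (b \o r) -> sat (upair FU s H) phi (b' \o r).
  by move=> n b b' r sb; split; apply: imp => //; exact: alike_sym.
elim: phi pF pG n b b' r => {m} [m|m t u|m R u|m p IHp q IHq|m p IHp] /= pF pG n b b' r sb.
- by [].
- have [t0 t0E] := @reduct_term m t (fun f ft => pF f (or_introl ft)).
  have [u0 u0E] := @reduct_term m u (fun f ft => pF f (or_intror ft)).
  have [bb' _ _ _] := sb; rewrite !t0E !u0E.
  exact: (same_type_ren r bb' (Equ t0 u0)).1.
- have /choice[u0 u0E] := fun j => @reduct_term m (u j) (fun f fu => pF f (ex_intro2 _ _ j Logic.I fu)).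
  have [bb' bH fb fb'] := sb.
  case: R u {pF} pG u0 u0E => [R|] u pG u0 u0E.
    have GR := pG R erefl.
    have := same_type_ren r bb' (@Rel (sublanguage F G) m (exist _ R GR) u0) => /= -[h _] h'.
    have uE v i : (fun j => urepr (eval (upair FU s H) v (u j)) i) =
        fun j => urepr (eval ultra v (u0 j)) i by apply/funext => j; rewrite u0E.
    by under eq_near do rewrite uE; apply: h; move: h'; under eq_near do rewrite uE.
  rewrite !u0E => uH; set c := eval ultra (b \o r) (u0 ord0).
  have dE : definable (fun N (t : structure (sublanguage F G) N) w =>
      w ord0 = eval t (w \o (@rshift 1 n \o r)) (u0 ord0)).
    have [t' t'E] := term_ren (@rshift 1 n \o r) (u0 ord0).
    by exists (Equ (Var _ ord0) t') => N t w /=; rewrite t'E.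
  have [j _ jc] : range b c.
    apply: fb => //; apply: (acl_intro (b := b) dE) => //.
    - by move=> i; left; exists i.
    - apply: (sub_finite_set _ (finite_set1 c)) => y /=; rewrite cons_head => ->.
      by congr eval; apply/funext => i /=; rewrite fcatr.
    - by rewrite cons_head; congr eval; apply/funext => i /=; rewrite fcatr.
  have dE' : definable (fun N (t : structure (sublanguage F G) N) w =>
      w j = eval t (w \o r) (u0 ord0)).
    have [t' t'E] := term_ren r (u0 ord0).
    by exists (Equ (Var _ j) t') => N t w /=; rewrite t'E.
  have /(same_type_definable bb' dE') <- := jc.
  by apply/bH; rewrite jc.
- move=> pq pb'; apply: (IHq _ _ _ b) => //.
    by move=> f fq; apply: pF; right.
    by move=> R Rq; apply: pG; right.
  apply: pq; apply: (IHp _ _ _ b') => //; last exact: alike_sym.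
    by move=> f fq; apply: pF; left.
    by move=> R Rq; apply: pG; left.
- move=> pb x'.
  have [q [b2' [b2 [r' [j [sb2 b'E bE jx']]]]]] :=
    alike_forth big tm eP Hsmall realize_in_H x' (alike_sym sb).
  have E (b3 : 'I_q -> ultraproduct) : b3 j .: ((b3 \o r') \o r) = b3 \o (j .: (r' \o r)).
    by rewrite cons_comp.
  rewrite -jx' b'E E; apply: (IHp pF pG _ b2); first exact: alike_sym.
  by rewrite -E -bE; exact: pb.
Qed.

End Preservation.

(** * Tameness of one-dimensional asymptotic classes *)

Section Tameness.
Variables (I : Type) (U : set_system I) (FU : UltraFilter U) (M : I -> finType).
Variables (L : language) (s : forall i, structure L (M i)).

Local Notation ultraproduct := (@ultraproduct I U FU (fun i => M i : Type)).

Lemma infinite_big : infinite_set [set: ultraproduct] -> big_sizes U M.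
Proof.
move=> inf k.
have dT : definable (fun N (t : structure L N) (w : 'I_(1 + 0) -> N) => True).
  by exists (Imp (Fal L _) (Fal L _)) => N t w; split=> // _ [].
have := atleast_ultra s k (fun i : 'I_0 => no_vars ultraproduct i) dT.
case=> + _ => /(_ (infinite_atleast inf k)); apply: filterS => i.
by move=> /leq_trans; apply; rewrite /size_of max_card.
Qed.

(** If mu >= d is a proportion, then c * sqrt #|M_i| is at most
    (d / 2) * #|M_i| once sqrt #|M_i| >= 2 * c / d, so a set whose size is close
    to mu * #|M_i| has size at least (d / 2) * #|M_i|. *)
Lemma asymptotic_tame (R : realType) (C : forall N : finType, structure L N -> Prop) :
  asymptotic_class R C -> (forall i, C (M i) (s i)) -> big_sizes U M -> tame U s.
Proof.
move=> asym Cs big n P [phi phiP]; have [c [E [c0 E0 dich _]]] := asym n phi.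
have [d d0 dE] : exists2 d : R, 0 < d & forall mu, mu \in E -> d <= mu.
  elim: E E0 {dich} => [|mu E IH] E0; first by exists 1; rewrite ?ltr01.
  have [|d d0 dE] := IH; first by move=> nu nuE; apply: E0; rewrite inE nuE orbT.
  have mu0 : 0 < mu by apply: E0; rewrite inE eqxx.
  exists (Num.min mu d); first by rewrite lt_min mu0.
  move=> nu; rewrite inE ge_min => /predU1P[->|/dE ->]; by rewrite ?lexx ?orbT.
pose k := maxn (Num.bound c) (Num.bound (2 / d)); exists k.
have [b bE] : exists b : nat, (2 * c / d) ^+ 2 <= b%:R :> R.
  exists (Num.bound ((2 * c / d) ^+ 2)).
  by apply: ltW; apply: archi_boundP; rewrite exprn_ge0 // divr_ge0 ?mulr_ge0 // ltW.
apply: filterS (big b) => i bM v.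
have -> : size_of [set x | P _ (s i) (x .: v)] = size_of [set x | sat (s i) phi (x .: v)].
  by congr size_of; apply/seteqP; split=> x /phiP.
set N := size_of _; have NE : N = #|[set x : M i | `[< sat (s i) phi (fcat (single x) v) >]]%SET| by [].
case: (dich _ _ (Cs i) v) => [|[mu muE]]; rewrite -NE.
  move=> Nc; left; rewrite -(ler_nat R) (le_trans Nc) // (le_trans (ltW (archi_boundP (ltW c0)))) //.
  by rewrite ler_nat leq_maxl.
rewrite ler_distl => /andP[lo _]; right.
set m := (#|M i|%:R : R) in lo *.
have m0 : 0 <= m by rewrite ler0n.
have sq : 2 * c / d <= Num.sqrt m.
  rewrite -(@ler_pXn2r _ 2) ?nnegrE ?sqrtr_ge0 // ?sqr_sqrtr //; last first.
    by rewrite divr_ge0 ?mulr_ge0 // ltW.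
  by rewrite (le_trans bE) // ler_nat.
have cs : c * Num.sqrt m <= d / 2 * m.
  rewrite -{2}(sqr_sqrtr m0) expr2 mulrA ler_wpM2r ?sqrtr_ge0 //.
  have -> : c = d / 2 * (2 * c / d) by field; rewrite gt_eqF.
  by rewrite ler_wpM2l // divr_ge0 // ltW.
have mN : d / 2 * m <= N%:R.
  apply: le_trans lo; rewrite lerBrDr (le_trans (lerD (lexx _) cs)) //.
  rewrite -mulrDl -splitr ler_wpM2r //; exact: dE.
rewrite -(ler_nat R) natrM -/m.
have kd : 2 / d <= k%:R.
  have d2 : 0 <= 2 / d by rewrite divr_ge0 // ltW.
  by rewrite (le_trans (ltW (archi_boundP d2))) // ler_nat leq_maxr.
apply: (@le_trans _ _ (2 / d * N%:R)); last by rewrite ler_wpM2r.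
apply: le_trans (ler_wpM2l _ mN); last by rewrite divr_ge0 // ltW.
by rewrite mulrA [_ * (d / 2)](_ : _ = 1) ?mul1r //; field; rewrite gt_eqF.
Qed.

Lemma tame_reduct F G : tame U s -> tame U (fun i => reduct F G (s i)).
Proof.
move=> tm n P [phi phiP]; have [k hk] := tm n _ (definable_reduct phi); exists k.
apply: filterS hk => i + v => /(_ v).
by rewrite (_ : [set x | sat _ phi (x .: v)] = [set x | P _ (reduct F G (s i)) (x .: v)]) //;
  apply/seteqP; split=> x /= /phiP.
Qed.

End Tameness.

(** * Realizing types in H *)

Lemma filter_finite_bigcap (T J : Type) (W : set_system T) (q : set J) (f : J -> set T) :
  Filter W -> finite_set q -> (forall j, q j -> W (f j)) -> W (\bigcap_(j in q) f j).
Proof.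
elim/Pchoice: J => J in q f * => FW /finite_fsetP[D ->] h.
by apply: filter_bigI => j; exact: h.
Qed.

Section RealizeInH.
Variables (I : Type) (U : set_system I) (FU : UltraFilter U) (M : I -> finType).
Variables (L : language) (s : forall i, structure L (M i)).
Variables (F : set (fsym L)) (G : set (rsym L)).
Let s0 i := reduct F G (s i).
Local Notation ultraproduct := (@ultraproduct I U FU (fun i => M i : Type)).

Lemma reduct_ultra n (phi : formula (sublanguage F G) n) v :
  sat (reduct F G (ultra_str FU s)) phi v <-> sat (ultra_str FU s0) phi v.
Proof. exact: sat_congr. Qed.

(** Distinct members of an independent tuple are distinct entries of b. *)
Lemma finite_dim_range n (b : 'I_n -> ultraproduct) : finite_dim (ultra_str FU s) (range b).
Proof.
exists n => k a ab; apply/bigmax_leqP => J /asboolP indJ.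
have /choice[r rE] : forall i, exists j, a i = b j.
  by move=> i; have [j _ <-] := ab (a i) (ex_intro2 _ _ i Logic.I erefl); exists j.
rewrite -(card_in_imset (f := r)); first by rewrite -[leqRHS]card_ord max_card.
move=> i j iJ jJ rij; apply/eqP; apply: contrapT => /negP ij.
apply: (indJ i iJ); apply: acl_incl; right; exists j; last by rewrite !rE rij.
by rewrite /= !inE eq_sym ij.
Qed.

(** The density of H is about complete L-types, whereas the type of c, transported
    to b', is only a type in the sublanguage.  Its formulas and the cofinite sets
    generate a proper filter; the formulas whose solution sets belong to a larger
    ultrafilter form a complete non-algebraic L-type. *)
Lemma realize_in_reduct (HS : set ultraproduct) n (b b' : 'I_n -> ultraproduct) c :
  H_structure (ultra_str FU s) HS -> same_type s0 b b' ->
  ~ acl (ultra_str FU s0) (range b) c ->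
  exists2 c', HS c' & same_type s0 (c .: b) (c' .: b').
Proof.
move=> [_ Hs] bb' cb.
(* the filter base, indexed by a formula of the type and a finite set to avoid *)
pose D := [set psiD : formula (sublanguage F G) (1 + n) * set ultraproduct |
  sat (ultra_str FU s0) psiD.1 (c .: b) /\ finite_set psiD.2].
pose B (psiD : formula (sublanguage F G) (1 + n) * set ultraproduct) :=
  [set x | sat (ultra_str FU s0) psiD.1 (x .: b')] `\` psiD.2.
pose T := Imp (Fal (sublanguage F G) (1 + n)) (Fal _ _).
have FF : Filter (filter_from D B).
  apply: filter_from_filter; first by exists (T, set0); split=> //; exact: finite_set0.
  move=> [psi A] [psi' A'] [/= psic Af] [/= psic' Af'].
  have [chi chiP] := definable_and (definable_sat psi) (definable_sat psi').
  exists (chi, A `|` A'); first by split; [exact/chiP|rewrite /= finite_setU].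
  by move=> x [/= /chiP[p p'] /not_orP[nA nA']].
have PF : ProperFilter (filter_from D B).
  apply: filter_from_proper => // -[psi A] [/= psic Af].
  apply: infinite_setN0; apply: infinite_setD => // /finite_atleast[k]; apply.
  apply/(same_type_definable bb' (definable_atleast k (definable_sat psi))).
  apply: infinite_atleast => fin; apply: cb.
  by apply: (acl_intro (definable_sat psi) _ fin).
have [W [UW FW]] := ultraFilterLemma PF.
pose p := [set f : pformula L ultraproduct 1 | params_in (range b') f /\ W (solutions (ultra_str FU s) f)].
have [|||[x Hx xp] _] := Hs (range b') p.
- exact: finite_dim_range.
- split=> [f []//|q qp fq|f fb'].
    have : W (\bigcap_(f in q) solutions (ultra_str FU s) f).
      by apply: filter_finite_bigcap => // g /qp[].
    by move=> /filter_ex[x xq]; exists x.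
  have [?|?] := in_ultra_setVsetC (solutions (ultra_str FU s) f) UW; [left|right]; by split.
- move=> f [_ Wf] fin.
  have : W (~` solutions (ultra_str FU s) f).
    by apply: FW; exists (T, solutions (ultra_str FU s) f) => [|x []]; first by split.
  by move=> /(filterI Wf)/filter_ex[x []].
exists x => //.
have imp psi : sat (ultra_str FU s0) psi (c .: b) -> sat (ultra_str FU s0) psi (x .: b').
  move=> psic; have [phi phiP] := definable_reduct psi.
  apply: (reduct_ultra _ _).1; apply: (phiP _ _ _).1; apply: (xp (PFormula (k := 1) phi b')); split=> /=.
    by move=> i; exists i.
  apply: FW; exists (psi, set0) => [|y [/= psiy _]]; first by split=> //; exact: finite_set0.
  by apply: (phiP _ _ _).2; apply: (reduct_ultra _ _).2.
move=> psi; split; first exact: imp.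
by move=> h; apply: contrapT => nh; have := imp (Neg psi) nh; apply.
Qed.

End RealizeInH.

(** * Lower bound *)

Section LowerBound.
Variables (I : Type) (U : set_system I) (FU : UltraFilter U) (M : I -> finType).
Variables (L : language) (s : forall i, structure L (M i)) (H : forall i, {set M i}).
Hypothesis big : big_sizes U M.
Hypothesis tm : tame U s.
Hypothesis Hsmall : subpolynomial U M (fun i => #|H i|).
Local Notation ultraproduct := (@ultraproduct I U FU (fun i => M i : Type)).
Local Notation HS := (@internal_set I U FU M H).
Hypothesis Hstr : H_structure (ultra_str FU s) HS.

Lemma acl_reduct F G (B : set ultraproduct) :
  acl (ultra_str FU (fun i => reduct F G (s i))) B `<=` acl (ultra_str FU s) B.
Proof.
move=> x [[n psi p] [/= pB fin px]]; have [phi phiP] := definable_reduct psi.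
apply: (acl_intro (b := p) (definable_sat phi)) => //.
  apply: sub_finite_set fin => y h.
  have h2 := (phiP _ _ _).1 h; exact: ((@reduct_ultra I U FU M L s F G _ psi _).1 h2).
exact: ((phiP _ _ _).2 ((@reduct_ultra I U FU M L s F G _ psi _).2 px)).
Qed.

Lemma countable_sig_inj (T : Type) (A : set T) : countable A ->
  exists c : {x | A x} -> nat, injective c.
Proof.
move=> /countable_injP[c cinj]; exists (c \o sval) => -[x Ax] [y Ay] /= cxy.
by apply: eq_exist; apply: cinj => //; exact/mem_set.
Qed.

(** If the projection were thin, [generic_tuple] would give a'_J outside it with
    (a_J, b) and (a'_J, b) alike, where b is an H-free tuple containing the
    parameters.  Extending this to an answer for all of a, [alike_sat] puts a'_J
    in the projection. *)
Theorem defset_not_thin n (a : 'I_n -> ultraproduct) (f : pformula (LH L) ultraproduct n)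
    d (j : 'I_d -> 'I_n) :
  psat (upair FU s H) f a -> indep_tuple s (a \o j) (range (pf_par f) `|` HS) ->
  ~ thin U M d (fun i => [set w : {ffun 'I_d -> M i} | exists2 x, x \in defset s H f i & w = [ffun t => x (j t)]]).
Proof.
case: f => q phi b0 /= sata ind thinX.
pose F : set (fsym L) := formula_fsyms phi; pose G := [set r | formula_rsyms phi (Some r)].
pose s0 i := reduct F G (s i).
have [cf cf_inj] := countable_sig_inj (formula_fsyms_countable phi).
have [|cr cr_inj] := @countable_sig_inj _ G.
  have /countable_injP[c cinj] := formula_rsyms_countable phi.
  apply/countable_injP; exists (c \o Some) => x y /set_mem Gx /set_mem Gy /= /cinj h.
  by have [] := h (mem_set Gx) (mem_set Gy).
have [e eP] : exists e : forall n, nat -> formula (sublanguage F G) n,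
    forall n phi, exists k, e n k = phi.
  pose ex m := @formula_enum (sublanguage F G) cf cr cf_inj cr_inj m.
  by exists (fun m => sval (cid (ex m))) => m; exact: (svalP (cid (ex m))).
have tm0 : tame U s0 by exact: tame_reduct.
have real_in_H m (b b' : 'I_m -> ultraproduct) c :
  same_type s0 b b' -> ~ acl (ultra_str FU s0) (range b) c ->
  exists2 c', HS c' & same_type s0 (c .: b) (c' .: b') by exact: realize_in_reduct.
have f0 : H_free s0 H (set0 : set ultraproduct).
  by move=> h hH; rewrite set0U => /acl_reduct hacl; case: (Hstr.1 h hH).
have [m [b [r [fb b0E bH]]]] := H_free_extend big tm0 b0 f0.
have ind0 : indep_tuple s0 (a \o j) (range b `|` HS).
  move=> t /acl_reduct; apply: contra_not (ind t); apply: acl_sub => x [[/bH[]|]|].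
  - by move=> h; left; left.
  - by move=> h; left; right.
  - by move=> h; left; right.
  - by move=> h; right.
have bb : alike s0 H b b by split.
have [a' [aa' a'X]] := generic_tuple big tm0 eP Hsmall bb ind0 (fun _ => thinX).
have [l [b2 [b2' [r2 [t [bb2 bE b'E aE]]]]]] := alike_forth_tuple big tm0 eP Hsmall real_in_H a aa'.
pose x' := b2' \o t.
have /los satx : sat (upair FU s H) phi (fcat x' b0).
  have e1 : fcat a b0 = b2 \o (fcat t (r2 \o @rshift d m \o r)).
    rewrite fcat_comp -aE b0E; congr fcat; apply/funext => u /=.
    by rewrite -[b2 _]/((b2 \o r2) _) -bE fcatr.
  have e2 : fcat x' b0 = b2' \o (fcat t (r2 \o @rshift d m \o r)).
    rewrite fcat_comp b0E; congr fcat; apply/funext => u /=.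
    by rewrite -[b2' _]/((b2' \o r2) _) -b'E fcatr.
  rewrite e2; apply/(alike_sat big tm0 eP Hsmall real_in_H _ _ _ bb2) => //.
  by rewrite -e1.
have x'E u : x' (j u) = a' u.
  have [st _ _ _] := bb2.
  have : b2 (t (j u)) = b2 (r2 (lshift m u)).
    by rewrite -[b2 (r2 _)]/((b2 \o r2) _) -bE fcatl -[b2 _]/((b2 \o t) _) -aE.
  move=> /(same_type_eq st); rewrite -[b2' (r2 _)]/((b2' \o r2) _) -b'E fcatl.
  exact.
have [i [nX satxi]] := filter_ex (filterI (a'X 0%N) satx).
apply: nX; exists [ffun u => slice x' i u].
  rewrite inE; apply/asboolP; move: satxi; rewrite slice_fcat /=.
  suff -> : ([ffun u => slice x' i u] : 'I_n -> M i) = slice x' i by [].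
  by apply/funext => u; rewrite ffunE.
by apply/ffunP => u; rewrite !ffunE /slice x'E.
Qed.

End LowerBound.

(** * Upper bound *)

Section UpperBound.
Variables (I : Type) (U : set_system I) (FU : UltraFilter U) (M : I -> finType).
Hypothesis big : big_sizes U M.

Lemma subpolynomial_mul (e e' : I -> nat) : subpolynomial U M e -> subpolynomial U M e' ->
  subpolynomial U M (fun i => e i * e' i)%N.
Proof.
move=> he he' k t; apply: filterS2 (he (k ^ 2)%N (t * 2)%N) (he' 1%N (t * 2)%N) => i hi hi'.
rewrite expnM in hi; rewrite expnM mul1n in hi'.
rewrite -(@leq_exp2r _ _ 2) // !expnMn mulnA.
by apply: leq_trans (leq_mul hi hi') _; rewrite mulnn.
Qed.

Lemma subpolynomial_prod (J : Type) (r : seq J) (e : J -> I -> nat) :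
  (forall j, subpolynomial U M (e j)) -> subpolynomial U M (fun i => \prod_(j <- r) e j i)%N.
Proof.
move=> he; elim: r => [|j r IH] k t.
  by apply: filterS (big k) => i; rewrite big_nil exp1n muln1.
by apply: filterS (subpolynomial_mul (he j) IH k t) => i; rewrite big_cons.
Qed.

Variables (L : language) (s : forall i, structure L (M i)) (H : forall i, {set M i}).
Local Notation ultraproduct := (@ultraproduct I U FU (fun i => M i : Type)).
Local Notation HS := (@internal_set I U FU M H).

Lemma definable_exists_H m n (P : relation (LH L) (m + n)) : definable P ->
  definable (fun N t (v : 'I_n -> N) => exists h : 'I_m -> N,
    (forall u, Hset t (h u)) /\ P N t (fcat h v)).
Proof.
elim: m P => [|m IH] P dP.
  apply: definable_iff dP => N t v; split=> [Pv|[h [_]]]; last by rewrite fcat_nil.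
  by exists (@no_vars N); split; [case|rewrite fcat_nil].
pose Q : relation (LH L) (m + n) := fun N t w => exists x, Hset t x /\ P N t (x .: w).
have dQ : definable Q.
  have dHP : definable (fun N (t : structure (LH L) N) w => Hset t (w ord0) /\ P N t w).
    apply: definable_and => //.
    by exists (@Rel (LH L) (1 + (m + n)) None (fun=> Var _ ord0)).
  by apply: definable_iff (definable_exists dHP) => N t w; split=> -[x h]; exists x; [move: h|]; rewrite /= cons_head.
apply: definable_iff (IH Q dQ) => N t v; split=> [[h [hH [x [xH Px]]]]|[h [hH Ph]]].
  exists (x .: h); split; last by rewrite -cons_fcat.
  by move=> u; case: (@split_ordP 1 m u) => w ->; rewrite ?fcatl ?fcatr.
exists (h \o @rshift 1 m); split=> [u|]; first exact: hH.
by exists (h ord0); split; [exact: hH|rewrite cons_fcat -cons_eta].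
Qed.

Lemma pformula_conj (L' : language) (N : Type) n k (f : 'I_k -> pformula L' N n) (A : set N) :
  (forall j, params_in A (f j)) -> exists2 g : pformula L' N n, params_in A g &
  forall N' (t : structure L' N') (p : N -> N') x,
    sat t (pf_form g) (fcat x (p \o pf_par g)) <->
    forall j, sat t (pf_form (f j)) (fcat x (p \o pf_par (f j))).
Proof.
elim: k f => [|k IH] f fA.
  exists (PFormula (Imp (Fal L' (n + 0)) (Fal L' _)) (@no_vars N)); first by case.
  by move=> N' t p x; split=> [_ []|_ //].
have [g gA gE] := IH (f \o @rshift 1 k) (fun j => fA _).
set q := pf_arity (f ord0); set q' := pf_arity g.
pose r1 : 'I_(n + q) -> 'I_(n + (q + q')) := fcat (@lshift n _) (@rshift n _ \o @lshift q q').
pose r2 : 'I_(n + q') -> 'I_(n + (q + q')) := fcat (@lshift n _) (@rshift n _ \o @rshift q q').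
have [psi psiE] := definable_and (definable_ren r1 (definable_sat (pf_form (f ord0))))
  (definable_ren r2 (definable_sat (pf_form g))).
exists (PFormula psi (fcat (pf_par (f ord0)) (pf_par g))).
  by move=> j /=; case: (split_ordP j) => u ->; rewrite ?fcatl ?fcatr; [exact: fA|exact: gA].
move=> N' t p x /=; rewrite psiE.
have -> : fcat x (p \o fcat (pf_par (f ord0)) (pf_par g)) \o r1 = fcat x (p \o pf_par (f ord0)).
  rewrite /r1 [LHS]fcat_comp; congr fcat; apply/funext => u /=; rewrite ?fcatl //.
  by rewrite fcatr /= fcatl.
have -> : fcat x (p \o fcat (pf_par (f ord0)) (pf_par g)) \o r2 = fcat x (p \o pf_par g).
  rewrite /r2 [LHS]fcat_comp; congr fcat; apply/funext => u /=; rewrite ?fcatl //.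
  by rewrite fcatr /= fcatr.
rewrite gE; split=> [[h0 h] j|h]; last by split=> // j; exact: h.
by case: (@split_ordP 1 k j) => u ->; [rewrite (_ : lshift k u = ord0) //; apply/val_inj; rewrite /= ord1|exact: h].
Qed.

(** Once x_J and h are fixed there are fewer than k solutions for x_c. *)
Lemma coordinate_bound n (a : 'I_n -> ultraproduct) (A : set ultraproduct) d (j : 'I_d -> 'I_n) c :
  acl (ultra_str FU s) (A `|` HS `|` range (a \o j)) (a c) ->
  exists f : pformula (LH L) ultraproduct n, exists m k,
  [/\ params_in A f, psat (upair FU s H) f a &
    forall i (w : 'I_d -> M i),
    (size_of [set y | exists x : {ffun 'I_n -> M i},
       [/\ x \in defset s H f i, forall t, x (j t) = w t & x c = y]] <= k * #|H i| ^ m)%N].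
Proof.
move=> hac; have [q [p [k [P [[phi phiP] bP pB Pa]]]]] := aclE hac.
have [n1 [p1 [n2 [p2 [r1 [p1A p2a pE]]]]]] := split_params pB.
have [n3 [al [m [h [r2 [alA hH p1E]]]]]] := split_params p1A.
have [r rE] : exists r : 'I_q -> 'I_(m + (d + n3)), p = fcat h (fcat (a \o j) al) \o r.
  have /choice[r rE] : forall t, exists u, p t = fcat h (fcat (a \o j) al) u.
    move=> t; rewrite pE /=; case: (split_ordP (r1 t)) => u ->.
      rewrite fcatl p1E /=; case: (split_ordP (r2 u)) => v ->.
        by rewrite fcatl; exists (rshift m (rshift d v)); rewrite !fcatr.
      by rewrite fcatr; exists (lshift _ v); rewrite fcatl.
    rewrite fcatr; have [v _ <-] := p2a u.
    by exists (rshift m (lshift _ v)); rewrite fcatr fcatl.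
  by exists r; apply/funext.
(* reads x_c and the parameters of phi off the variables h, x and alpha;
   of x only x_c and the x_(j t) are used *)
pose rho : 'I_(1 + q) -> 'I_(m + (n + n3)) :=
  rshift m (lshift n3 c) .: (fcat (@lshift m _) (@rshift m _ \o fcat (@lshift n n3 \o j) (@rshift n n3)) \o r).
have rhoE N (h' : 'I_m -> N) (x : 'I_n -> N) (al' : 'I_n3 -> N) :
    fcat h' (fcat x al') \o rho = x c .: (fcat h' (fcat (x \o j) al') \o r).
  rewrite /rho cons_comp fcatr fcatl; congr fcat; apply/funext => u /=.
  case: (split_ordP (r u)) => v ->; rewrite !(fcatl, fcatr) //=.
  by rewrite ?fcatr; case: (split_ordP v) => v' ->; rewrite !(fcatl, fcatr) /= ?(fcatl, fcatr).
have [psi psiP] := definable_exists_H (definable_ren rho (definable_forget_H phi)).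
exists (PFormula psi al), m, k; split=> //.
  apply/psiP; exists h; split; first exact: hH.
  rewrite rhoE -rE.
  exact: ((@sat_congr _ _ phi _ (ultra_str FU s) (forget_H (upair FU s H)) _ erefl erefl).1
    ((phiP _ _ _).2 Pa)).
move=> i w.
pose D : set {ffun 'I_m -> M i} := [set h' | forall t, h' t \in H i].
pose Q (h' : {ffun 'I_m -> M i}) : set (M i) :=
  [set y | P _ (s i) (y .: (fcat h' (fcat w (slice al i)) \o r))].
have Qk h' : D h' -> (size_of (Q h') <= k)%N.
  move=> _; rewrite leqNgt; apply/negP => /ltnW/atleast_card; exact: bP.
apply: (@leq_trans (size_of [set y | exists2 h', D h' & Q h' y])); last first.
  apply: leq_trans (union_bound Qk) _; rewrite leq_mul2l; apply/orP; right.
  exact: size_ffun_on.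
apply: size_ofS => y [x [+ xw xy]]; rewrite inE => /asboolP/psiP[h' [h'H]].
rewrite rhoE xy => hphi; exists [ffun t => h' t]; first by move=> t; rewrite ffunE; exact: h'H.
rewrite /Q /= -(_ : x \o j = w); last exact/funext.
rewrite (_ : ([ffun t => h' t] : 'I_m -> M i) = h'); last by apply/funext => t; rewrite ffunE.
apply: (phiP _ _ _).1.
exact: ((@sat_congr _ _ phi _ (s i) (forget_H (finite_pairs s H i)) _ erefl erefl).2 hphi).
Qed.

Hypothesis Hsmall : subpolynomial U M (fun i => #|H i|).

(** The set is contained in the union, over the values w of x_J, of products of
    the sets from [coordinate_bound]. *)
Lemma spanned_bound n (a : 'I_n -> ultraproduct) (A : set ultraproduct) d (j : 'I_d -> 'I_n) :
  (forall c, acl (ultra_str FU s) (A `|` HS `|` range (a \o j)) (a c)) ->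
  exists f : pformula (LH L) ultraproduct n, exists e,
  [/\ params_in A f, psat (upair FU s H) f a, subpolynomial U M e &
    forall i, (#|defset s H f i| <= e i * #|M i| ^ d)%N].
Proof.
move=> span; have /choice[f fP] := fun c => coordinate_bound (span c).
have /choice[m mP] := fP; have /choice[k kP] := mP.
have [|g gA gP] := @pformula_conj _ _ _ _ f A; first by move=> c; have [] := kP c.
exists g, (fun i => \prod_(c < n) (k c * #|H i| ^ m c))%N; split=> //.
- by apply/(gP _ (upair FU s H) id) => c; have [_ ? _] := kP c.
- apply: subpolynomial_prod => c l t.
  apply: filterS (Hsmall (l * k c ^ t)%N (m c * t)%N) => i.
  by rewrite expnMn expnM mulnA.
move=> i; pose R (w : {ffun 'I_d -> M i}) : set {ffun 'I_n -> M i} :=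
  [set x | x \in defset s H g i /\ forall t, x (j t) = w t].
have Rk w : [set: {ffun 'I_d -> M i}] w ->
    (size_of (R w) <= \prod_(c < n) (k c * #|H i| ^ m c))%N.
  move=> _; pose S c : {set M i} := [set y | `[< exists x : {ffun 'I_n -> M i},
       [/\ x \in defset s H (f c) i, forall t, x (j t) = w t & x c = y] >]]%SET.
  apply: (@leq_trans #|family S|).
    apply/subset_leq_card/fintype.subsetP => x; rewrite in_asbool => /asboolP[xg xw].
    apply/familyP => c; rewrite inE; apply/asboolP; exists x; split=> //.
    move: xg; rewrite !finset.in_set => /asboolP xg; apply/asboolP.
    exact: ((gP _ (finite_pairs s H i) (fun z => urepr z i) x).1 xg c).
  rewrite card_family foldrE big_map big_enum /=; apply: leq_prod => c _.
  by have [_ _] := kP c; exact.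
have := union_bound Rk; rewrite size_ofT card_ffun card_ord; apply: leq_trans.
apply/subset_leq_card/fintype.subsetP => x xg; rewrite in_asbool; apply/asboolP.
by exists [ffun t => x (j t)] => //; split=> // t; rewrite ffunE.
Qed.

End UpperBound.

(** * Coarse dimension as a limit *)

Section CoarseLimits.
Variables (R : realType) (I : Type) (U : set_system I) (FU : UltraFilter U) (M : I -> finType).
Hypothesis big : big_sizes U M.

Lemma ultra_fmap (T : Type) (f : I -> T) : UltraFilter (f @ U).
Proof.
split; first exact: fmap_proper_filter.
move=> G GF fG; apply/seteqP; split=> // A GA.
have [//|nA] := in_ultra_setVsetC (f @^-1` A) FU.
have : G (~` A) by apply: fG.
by move=> /(filterI GA)/filter_ex[x []].
Qed.

Let lM i : R := ln #|M i|%:R.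

Lemma ln_big (z : R) : \forall i \near U, z <= lM i.
Proof.
apply: filterS (big (Num.bound (expR z))) => i bM.
rewrite -[z]expRK ler_ln ?posrE ?expR_gt0 //.
  by rewrite (le_trans (ltW (archi_boundP (expR_ge0 z)))) // ler_nat.
rewrite ltr0n; apply: leq_trans bM; rewrite -(ltr_nat R).
exact: lt_trans (expR_gt0 z) (archi_boundP (expR_ge0 z)).
Qed.

Lemma ln_natX (x t : nat) : ln (x ^ t)%:R = t%:R * ln x%:R :> R.
Proof.
case: x => [|x]; last by rewrite natrX lnXn ?ltr0Sn // mulr_natl.
by rewrite [ln 0%:R]ln0 // mulr0; case: t => [|t]; rewrite ?expn0 ?exp0n ?ln1 ?ln0.
Qed.

(** The constant k is absorbed by the gap: ln k <= (d - z) * ln #|M_i|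
    for almost all i. *)
Lemma ln_thin (x : I -> nat) d (z : R) : z < d%:R ->
  (\forall i \near U, ln (x i)%:R <= z * lM i) ->
  forall k, \forall i \near U, (k * x i <= #|M i| ^ d)%N.
Proof.
move=> zd xz k; apply: filterS3 xz (ln_big (ln k%:R / (d%:R - z))) (big 1) => i xi Mi M0.
have dz : 0 < d%:R - z by rewrite subr_gt0.
case: (posnP (x i)) => [->|x0]; first by rewrite muln0.
case: (posnP k) => [->//|k0].
rewrite -(ler_nat R) -ler_ln ?posrE ?ltr0n ?expn_gt0 ?M0 ?muln_gt0 ?k0 //.
rewrite natrM lnM ?posrE ?ltr0n // ln_natX -/(lM i).
move: Mi; rewrite ler_pdivrMr // => Mi.
apply: le_trans (lerD Mi xi) _.
by rewrite [leLHS](_ : _ = d%:R * lM i) //; ring.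
Qed.

(** The ratio is bounded, and an ultrafilter on a compact interval converges, so
    that [delta] is a genuine limit. *)
Lemma delta_cvg (T : I -> finType) (X : forall i, {set T i}) n :
  (\forall i \near U, (#|X i| <= #|M i| ^ n)%N) ->
  (fun i => ln (#|X i|%:R : R) / ln (#|M i|%:R : R)) @ U --> delta R U M X.
Proof.
move=> Xn; set f := fun i => _.
have fin : \forall i \near U, `[0, n%:R]%classic (f i).
  apply: filterS2 Xn (big 2) => i Xi Mi; rewrite /f /= in_itv /=.
  have l0 : 0 < ln (#|M i|%:R : R) by rewrite ln_gt0 // ltr1n.
  have lX : 0 <= ln (#|X i|%:R : R).
    by case: #|X i| => [|m]; [rewrite ln0|rewrite ln_ge0 // ler1n].
  rewrite divr_ge0 ?(ltW l0) //= ler_pdivrMr // -ln_natX.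
  case: (posnP #|X i|) => [->|X0].
    by rewrite ln0 // ln_natX mulr_ge0 // ltW.
  by rewrite ler_ln ?posrE ?ltr0n ?ler_nat // expn_gt0 (ltn_trans _ Mi).
have := @segment_compact R 0 n%:R; rewrite compact_ultra => /(_ _ (ultra_fmap f) fin).
by move=> [l [_ fl]]; rewrite /delta (cvg_lim _ fl).
Qed.

Lemma delta_lt_thin (T : I -> finType) (X : forall i, {set T i}) n d :
  (\forall i \near U, (#|X i| <= #|M i| ^ n)%N) -> delta R U M X < d%:R ->
  forall k, \forall i \near U, (k * #|X i| <= #|M i| ^ d)%N.
Proof.
move=> /delta_cvg Xn Xd.
(* any value strictly between the limit and d *)
pose z := (delta R U M X + d%:R) / 2.
have [z1 z2] : delta R U M X < z /\ z < d%:R by rewrite /z; split; lra.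
have Xz : \forall i \near U, ln (#|X i|%:R : R) / ln (#|M i|%:R : R) <= z.
  exact: cvgr_le _ Xn _ z1.
have Xln : \forall i \near U, ln (#|X i|%:R : R) <= z * lM i.
  apply: filterS2 Xz (big 2) => i /= + Mi.
  by rewrite ler_pdivrMr // ln_gt0 // ltr1n.
exact: ln_thin z2 Xln.
Qed.

Lemma delta0_subpolynomial (H : forall i, {set M i}) :
  delta R U M H = 0 -> subpolynomial U M (fun i => #|H i|).
Proof.
move=> H0 k t.
have /delta_cvg : \forall i \near U, (#|H i| <= #|M i| ^ 1)%N.
  by apply: nearW => i; rewrite expn1 max_card.
rewrite H0; set f := fun i => _ => f0.
have z0 : 0 < (2 * t.+1%:R)^-1 :> R by rewrite invr_gt0 mulr_gt0.
have half : 2^-1 < 1%:R :> R by lra.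
suff : \forall i \near U, (k * #|H i| ^ t <= #|M i| ^ 1)%N by apply: filterS => i; rewrite expn1.
have fz : \forall i \near U, f i <= (2 * t.+1%:R)^-1.
  exact: cvgr_le _ f0 _ z0.
suff hln : \forall i \near U, ln ((#|H i| ^ t)%N%:R : R) <= 2^-1 * lM i by exact: ln_thin half hln k.
apply: filterS2 fz (big 2) => i /= fi Mi.
have l0 : 0 < ln (#|M i|%:R : R) by rewrite ln_gt0 // ltr1n.
move: fi; rewrite /f ler_pdivrMr // ln_natX => fi.
apply: le_trans (ler_wpM2l (ler0n R t) fi) _; rewrite mulrA ler_wpM2r // ?ltW //.
by rewrite ltr_pdivrMr ?mulr_gt0 // mulrA mulVf ?pnatr_eq0 // mul1r ltr_nat.
Qed.

(** The extra factor #|M_i| changes the ratio by 1 / t only; this way of bounding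
    the size by #|M_i| ^ d up to a subpolynomial factor avoids real exponents. *)
Lemma delta_le (T : I -> finType) (X : forall i, {set T i}) d :
  (forall t, \forall i \near U, (#|X i| ^ t <= #|M i| ^ (d * t + 1))%N) ->
  delta R U M X <= d%:R.
Proof.
move=> Xt.
have Xn : \forall i \near U, (#|X i| <= #|M i| ^ (d * 1 + 1))%N.
  by apply: filterS (Xt 1%N) => i; rewrite expn1.
have := delta_cvg Xn; set f := fun i => _ => fX.
apply/ler_addgt0Pr => eps eps0.
pose t := (Num.bound (eps^-1)).
have t0 : eps^-1 < t%:R by apply: archi_boundP; rewrite invr_ge0 ltW.
have tp : 0 < t%:R :> R by apply: lt_trans t0; rewrite invr_gt0.
have tN : (0 < t)%N by rewrite -(ltr0n R).
apply: (cvgr_to_le fX); apply: filterS2 (Xt t) (big 2) => i Xi Mi.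
have l0 : 0 < ln (#|M i|%:R : R) by rewrite ln_gt0 // ltr1n.
rewrite /f ler_pdivrMr // -(ler_pM2l tp) -ln_natX.
have : ln (#|X i| ^ t)%:R <= ln (#|M i| ^ (d * t + 1))%:R :> R.
  case: (posnP #|X i|) => [X0|X0].
    by rewrite X0 exp0n // ln0 // ln_natX mulr_ge0 // ltW.
  by rewrite ler_ln ?posrE ?ltr0n ?expn_gt0 ?X0 ?(ltn_trans _ Mi) // ler_nat.
move=> /le_trans; apply; rewrite ln_natX mulrA ler_wpM2r ?(ltW l0) //.
rewrite natrD natrM mulrDr mulrC lerD2l.
by rewrite -[leLHS](mulVf (lt0r_neq0 eps0)) ler_wpM2r // ltW.
Qed.

End CoarseLimits.

(** * Bases, and the equality of the dimensions *)

Section Dimension.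
Variables (I : Type) (U : set_system I) (FU : UltraFilter U) (M : I -> finType).
Variables (L : language) (s : forall i, structure L (M i)).
Hypothesis big : big_sizes U M.
Hypothesis tm : tame U s.
Local Notation ultraproduct := (@ultraproduct I U FU (fun i => M i : Type)).
Let ultra := ultra_str FU s.

(** By exchange an independent subtuple of the largest size spans. *)
Lemma dim_basis n (a : 'I_n -> ultraproduct) B : exists J : {set 'I_n},
  [/\ Defs.dim ultra a B = #|J|, indep_subtuple ultra a B J &
      forall c, acl ultra (B `|` [set a l | l in [set l | l \in J]]) (a c)].
Proof.
have P0 : `[< indep_subtuple ultra a B finset.set0 >].
  by apply/asboolP => i; rewrite finset.in_set0.
pose J := [arg max_(K > finset.set0 | `[< indep_subtuple ultra a B K >]) #|K|].
have dimJ : Defs.dim ultra a B = #|J| by exact: bigmax_eq_arg.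
have [indJ maxJ] : indep_subtuple ultra a B J /\
    forall K, indep_subtuple ultra a B K -> (#|K| <= #|J|)%N.
  rewrite /J; case: arg_maxnP => // K /asboolP indK maxK; split=> // K' indK'.
  exact/maxK/asboolP.
exists J; split=> // c; case: (boolP (c \in J)) => cJ.
  by apply: acl_incl; right; exists c.
have [i iK hi] : exists2 i, i \in (c |: J)%SET &
    acl ultra (B `|` [set a l | l in [set l | l \in ((c |: J) :\ i)%SET]]) (a i).
  apply: contrapT => ni; have : (#|(c |: J)%SET| <= #|J|)%N.
    by apply: maxJ => i iK hi; apply: ni; exists i.
  by rewrite cardsU1 cJ ltnn.
case: (eqVneq i c) => [ic|ic].
  move: hi; rewrite ic; apply: acl_sub => x [Bx|[l /= + <-]]; first by left.
  by rewrite !finset.inE => /andP[/negbTE -> /=] lJ; right; exists l.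
have iJ : i \in J by move: iK; rewrite !finset.inE (negbTE ic).
have := indJ i iJ; set B' := B `|` _ => ni.
have hi' : acl ultra (B' `|` [set a c]) (a i).
  apply: acl_sub hi => x [Bx|[l /= + <-]]; first by left; left.
  rewrite !finset.inE => /andP[li /orP[/eqP ->|lJ]]; first by right.
  by left; right; exists l => //=; rewrite !finset.inE li.
apply: acl_sub (exchange big tm hi' ni) => x [[Bx|[l /= + <-]]|->]; first by left.
  by rewrite !finset.inE => /andP[_ lJ]; right; exists l.
by right; exists i.
Qed.

End Dimension.

Theorem theorem4p5 (R : realType) (L : language)
    (C : forall N : finType, structure L N -> Prop)
    (I : Type) (U : set_system I) (FU : UltraFilter U)
    (M : I -> finType) (s : forall i, structure L (M i))
    (H : forall i, {set M i}) :
  asymptotic_class R C ->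
  (forall i, C (M i) (s i)) ->
  infinite_set [set: ultraproduct FU M] ->
  nowhere_trivial (Th (ultra_str FU s)) ->
  H_structure (ultra_str FU s) (Hset (upair FU s H)) ->
  delta R U M H = 0 ->
  forall (n : nat) (a : 'I_n -> ultraproduct FU M)
    (A : set (ultraproduct FU M)),
  countable A ->
  (ldim (ultra_str FU s) (Hset (upair FU s H)) a A)%:R
    = delta_tuple R s H a A.
Proof.
move=> asym Cs inf _ Hstr H0 n a A _.
have big : big_sizes U M by exact: infinite_big s inf.
have tm : tame U s by exact: asymptotic_tame asym Cs big.
have Hsmall := delta0_subpolynomial FU big H0.
rewrite /ldim; have [J [-> indJ spanJ]] := dim_basis big tm a (A `|` Hset (upair FU s H)).
set d := #|J|; pose j : 'I_d -> 'I_n := enum_val.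
have jJ : [set a l | l in [set l | l \in J]] `<=` range (a \o j).
  by move=> x [l /= lJ <-]; exists (enum_rank_in lJ l); rewrite //= /j enum_rankK_in.
have size_defset (f : pformula (LH L) (ultraproduct FU M) n) i :
    (#|defset s H f i| <= #|M i| ^ n)%N.
  by rewrite -[n in (_ ^ n)%N]card_ord -card_ffun max_card.
have [|f0 [e [f0A f0a esub f0le]]] := @spanned_bound I U FU M big L s H Hsmall n a A d j.
  move=> c; apply: acl_sub (spanJ c) => x [Bx|/jJ ?]; [by left|by right].
have lower (f : pformula (LH L) (ultraproduct FU M) n) :
    params_in A f -> psat (upair FU s H) f a -> d%:R <= delta R U M (defset s H f).
  move=> fA fa; rewrite leNgt; apply/negP => df.
  have thinf k : \forall i \near U, (k * #|defset s H f i| <= #|M i| ^ d)%N.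
    by apply: (delta_lt_thin FU big _ df); apply: nearW; exact: size_defset.
  apply: (defset_not_thin big tm Hsmall Hstr (j := j) fa).
    move=> t; have := indJ (j t) (enum_valP t); apply: contra_not; apply: acl_sub.
    move=> x [[[u _ <-]|Hx]|[l /= tl <-]]; [by left; left; exact: fA|by left; right|].
    right; exists (j l) => //=; rewrite !finset.inE enum_valP andbT.
    by rewrite (inj_eq enum_val_inj) -val_eqE neq_ltn tl orbT.
  move=> k; apply: filterS (thinf k) => i; apply: leq_trans; rewrite leq_mul2l; apply/orP; right.
  apply: leq_trans (leq_imset_card (fun x : {ffun 'I_n -> M i} => [ffun t => x (j t)]) _).
  apply/subset_leq_card/fintype.subsetP => w; rewrite in_asbool => /asboolP[x xf ->].
  exact: imset_f.
apply/eqP; rewrite eq_le; apply/andP; split.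
  apply: lb_le_inf; first by exists (delta R U M (defset s H f0)); exists f0.
  by move=> _ [f [fA fa] <-]; exact: lower.
apply: (@le_trans _ _ (delta R U M (defset s H f0))).
  apply: ge_inf; last by exists f0.
  by exists d%:R => _ [f [fA fa] <-]; exact: lower.
apply: (@delta_le R I U FU M big _ (defset s H f0) d) => t.
apply: filterS (esub 1%N t) => i; rewrite mul1n => et.
have : (#|defset s H f0 i| ^ t <= (e i * #|M i| ^ d) ^ t)%N.
  by case: t {et} => // t; rewrite leq_exp2r.
by move=> /leq_trans; apply; rewrite expnMn -expnM addn1 expnS leq_mul2r et orbT.
Qed.
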